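(* Let $\Omega\subset\mathbb{R}^d$ be open and bounded, and let $\nu$ be the density of a symmetric Lévy measure with full support such that the couple $(\nu,\Omega)$ belongs to one of the classes $\mathscr{A}_i$, $i=0,1,2,3$. Let $k:(\mathbb{R}^d\times\mathbb{R}^d)\setminus\operatorname{diag}\to[0,\infty)$ be symmetric and measurable with $\Lambda^{-1}\nu(y-x)\le k(x,y)\le\Lambda\nu(y-x)$ for all $x\neq y$ and some $\Lambda\ge1$. Let $f\in L^2(\Omega)$ and $g\in L^2(\Omega^c,\widetilde\nu^{-1})$. (i) There exists a unique $u\in V_\nu(\Omega|\mathbb{R}^d)^\perp$ with $$\mathcal{E}(u,v)=\int_\Omega f(x)v(x)\,dx+\int_{\Omega^c}g(y)v(y)\,dy\qquad\text{for all }v\in V_\nu(\Omega|\mathbb{R}^d)^\perp,$$ and it satisfies $$\|u\|_{V_\nu(\Omega|\mathbb{R}^d)}\le C\big(\|f\|_{L^2(\Omega)}+\|g\|_{L^2(\Omega^c,\widetilde\nu^{-1})}\big)$$ with a positive constant $C$ depending only on $d,\Omega,\Lambda$ and $\nu$ (and the fixed set $B$ in the definition of $\widetilde\nu$). (ii) The problem of finding $w\in V_\nu(\Omega|\mathbb{R}^d)$ with $$\mathcal{E}(w,v)=\int_\Omega f(x)v(x)\,dx+\int_{\Omega^c}g(y)v(y)\,dy\qquad\text{for all }v\in V_\nu(\Omega|\mathbb{R}^d)$$ is solvable if and only if $\int_\Omega f(x)\,dx+\int_{\Omega^c}g(y)\,dy=0$. In that case all solutions $w$ are of the form $w=u+c$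 with $c\in\mathbb{R}$, and they satisfy $$\Big\|w-\tfrac1{|\Omega|}\int_\Omega w\Big\|_{V_\nu(\Omega|\mathbb{R}^d)}\le C\big(\|f\|_{L^2(\Omega)}+\|g\|_{L^2(\Omega^c,\widetilde\nu^{-1})}\big).$$
   Context: $V_\nu(\Omega|\mathbb{R}^d)$ is the space of (a.e.-classes of) measurable $u:\mathbb{R}^d\to\mathbb{R}$ with $u|_\Omega\in L^2(\Omega)$ and $|u|^2=\int_\Omega\int_{\mathbb{R}^d}(u(x)-u(y))^2\nu(x-y)\,dy\,dx<\infty$, normed by $\|u\|^2_{V_\nu(\Omega|\mathbb{R}^d)}=\|u\|^2_{L^2(\Omega)}+|u|^2$; $V_\nu(\Omega|\mathbb{R}^d)^\perp=\{u\in V_\nu(\Omega|\mathbb{R}^d):\int_\Omega u\,dx=0\}$. $\mathcal{E}(u,v)=\frac12\iint_{(\Omega^c\times\Omega^c)^c}(u(x)-u(y))(v(x)-v(y))k(x,y)\,dx\,dy$. $\widetilde\nu(x)=\int_B(1\wedge\nu(x-y))\,dy$ for a fixed nonempty open $B\subset\Omega$; $L^2(\Omega^c,\widetilde\nu^{-1})$ is the $L^2$-space for the measure $\widetilde\nu(x)^{-1}dx$ on $\Omega^c$. Full support: the support of $\nu(h)\,dh$ is $\mathbb{R}^d$. $H_\nu(\Omega)=\{u\in L^2(\Omega):\mathcal{E}_\Omega(u,u)<\infty\}$, $\mathcal{E}_\Omega(u,u)=\iint_{\Omega\times\Omega}(u(x)-u(y))^2\nu(x-y)\,dx\,dy$,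 $\|u\|^2_{H_\nu(\Omega)}=\|u\|^2_{L^2(\Omega)}+\mathcal{E}_\Omega(u,u)$ (similarly on $\mathbb{R}^d$). Classes: let $\Omega$ be open and bounded, $\nu:\mathbb{R}^d\setminus\{0\}\to[0,\infty)$ measurable with $\nu(h)=\nu(-h)$ and $\int_{\mathbb{R}^d}(1\wedge|h|^2)\nu(h)\,dh<\infty$. $(\nu,\Omega)$ is in $\mathscr{A}_0$ if $\nu$ has full support and is unimodal, i.e. radial with $\nu(r)\le c\,\nu(s)$ for all $0<s\le r$ and some $c\ge1$. If in addition $\int_{\mathbb{R}^d}\nu=\infty$, $(\nu,\Omega)$ is in $\mathscr{A}_1$ if there is $E:H_\nu(\Omega)\to H_\nu(\mathbb{R}^d)$ and $C>0$ with $\|Eu\|_{H_\nu(\mathbb{R}^d)}\le C\|u\|_{H_\nu(\Omega)}$, $Eu|_\Omega=u$ for every $u\in H_\nu(\Omega)$; in $\mathscr{A}_2$ if $\partial\Omega$ is Lipschitz-continuous, $\nu$ is radial and $\delta^{-2}\int_{B_\delta(0)}|h|^2\nu(h)\,dh\to\infty$ as $\delta\to0$; in $\mathscr{A}_3$ if $\inf_{a\in\partial\Omega}\int_{\Omega_\delta}\nu(h-a)\,dh\to\infty$ as $\delta\to0$, where $\Omega_\delta=\{x\in\Omega:\operatorname{dist}(x,\partial\Omega)>\delta\}$. *)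

(* Defs.v *)
From HB Require Import structures.
From mathcomp Require Import all_boot all_order all_algebra.
From mathcomp Require Import all_classical all_reals all_analysis.

Set Implicit Arguments.
Unset Strict Implicit.
Unset Printing Implicit Defensive.

Import Order.TTheory GRing.Theory Num.Theory.
Import numFieldNormedType.Exports.

Local Open Scope classical_set_scope.
Local Open Scope ring_scope.

Definition measure_rV_display : measure_display. Proof. exact. Qed.

(* The sigma-algebra on R^n = 'rV[R]_n is generated by the coordinates; it is the
   Borel sigma-algebra (open_measurable_rV below). Measurable always means Borel
   measurable, and function spaces are spaces of Borel functions considered up to
   a.e. equality, so no a.e. class of Lebesgue measurable functions is lost. *)
Section measurable_rV.
Context {R : realType} (n : nat).

Definition rV_measurable : set (set 'rV[R]_n) :=
  <<s \bigcup_(i in [set: 'I_n])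
        preimage_set_system [set: 'rV[R]_n] (fun x : 'rV[R]_n => x ord0 i)
          (@measurable _ (measurableTypeR R)) >>.

Let rV_measurable0 : rV_measurable set0.
Proof. exact: sigma_algebra0. Qed.

Let rV_measurableC A : rV_measurable A -> rV_measurable (~` A).
Proof. exact: sigma_algebraC. Qed.

Let rV_measurable_bigcup (F : (set 'rV[R]_n)^nat) :
  (forall i, rV_measurable (F i)) -> rV_measurable (\bigcup_i F i).
Proof. exact: sigma_algebra_bigcup. Qed.

#[warning="-redundant-canonical-projection"]
HB.instance Definition _ := @isMeasurable.Build measure_rV_display 'rV[R]_n
  rV_measurable rV_measurable0 rV_measurableC rV_measurable_bigcup.
End measurable_rV.

Section lebesgue_rV.
Context {R : realType}.
Lemma measurable_coord n (i : 'I_n) :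
  measurable_fun setT (fun x : 'rV[R]_n => x ord0 i).
Proof.
move=> _ Y mY; apply: sub_sigma_algebra; exists i => //.
by exists Y.
Qed.

Lemma measurable_fun_rVP d (T : measurableType d) n (f : T -> 'rV[R]_n) :
  measurable_fun setT f <->
  forall i, measurable_fun setT (fun t => f t ord0 i).
Proof.
split=> [mf i|mf]; first exact: (measurableT_comp (measurable_coord i) mf).
apply: (measurability _ (erefl (@measurable _ 'rV[R]_n))).
move=> _ [_ [i _ [Y mY <-]] <-].
rewrite !setTI -[X in measurable X]setTI.
exact: mf.
Qed.
Definition rV_cons n (p : R * 'rV[R]_n) : 'rV[R]_n.+1 :=
  \row_i (if unlift ord0 i is Some j then p.2 ord0 j else p.1).

Lemma rV_cons0 n (p : R * 'rV[R]_n) : rV_cons p ord0 ord0 = p.1.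
Proof. by rewrite mxE unlift_none. Qed.

Lemma rV_consS n (p : R * 'rV[R]_n) j : rV_cons p ord0 (lift ord0 j) = p.2 ord0 j.
Proof. by rewrite mxE liftK. Qed.

Lemma measurable_rV_cons n : measurable_fun setT (@rV_cons n).
Proof.
apply/measurable_fun_rVP => i; case: (unliftP ord0 i) => [j|] ->.
  under eq_fun do rewrite rV_consS.
  exact: (measurableT_comp (measurable_coord j)).
under eq_fun do rewrite rV_cons0.
exact: measurable_fst.
Qed.

Definition rV_uncons n (y : 'rV[R]_n.+1) : R * 'rV[R]_n :=
  (y ord0 ord0, \row_j y ord0 (lift ord0 j)).

Lemma rV_consK n : cancel (@rV_cons n) (@rV_uncons n).
Proof.
case=> a x; congr pair; first by rewrite rV_cons0.
by apply/rowP => j; rewrite mxE rV_consS.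
Qed.

Lemma rV_unconsK n : cancel (@rV_uncons n) (@rV_cons n).
Proof.
move=> y; apply/rowP => i; case: (unliftP ord0 i) => [j|] ->.
  by rewrite rV_consS mxE.
by rewrite rV_cons0.
Qed.

Lemma measurable_rV_uncons n : measurable_fun setT (@rV_uncons n).
Proof.
apply: measurable_fun_pair; first exact: measurable_coord.
apply/measurable_fun_rVP => j; under eq_fun do rewrite mxE.
exact: measurable_coord.
Qed.

(* Lebesgue measure on R^n, with no completion; lebesgue_rV_box computes it on
   boxes. *)
Fixpoint lebesgue_rV n : set 'rV[R]_n -> \bar R :=
  match n with
  | 0 => \d_(0 : 'rV[R]_0)
  | m.+1 => pushforward (lebesgue_measure \x @lebesgue_rV m)%E (@rV_cons m)
  end.

Lemma lebesgue_rV_spec n : {m : {sigma_finite_measure set 'rV[R]_n -> \bar R} |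
  m = @lebesgue_rV n :> (set _ -> \bar R)}.
Proof.
elim: n => [|n [m mE]]; first by exists \d_(0 : 'rV[R]_0).
pose mu := (lebesgue_measure \x m)%E.
pose nu := pushforward mu (@rV_cons n).
have nuE : nu = @lebesgue_rV n.+1 by rewrite /nu /mu mE.
pose nm : {measure set 'rV[R]_n.+1 -> \bar R} :=
  measure_function_pushforward__canonical__measure_function_Measure mu
    (@measurable_rV_cons n).
have sf : sigma_finite setT nm.
  have /sigma_finiteP[F [FT ndF Foo]] :=
    @sigma_finiteT _ _ _ (@lebesgue_measure R).
  have /sigma_finiteP[G [GT ndG Goo]] := sigma_finiteT m.
  exists (fun k => @rV_uncons n @^-1` (F k `*` G k)).
    rewrite -preimage_bigcup (_ : \bigcup_k _ = setT) ?preimage_setT//.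
    rewrite -subTset => -[a x] _.
    have [i _ Fi] : (\bigcup_i F i) a by rewrite -FT.
    have [j _ Gj] : (\bigcup_i G i) x by rewrite -GT.
    exists (maxn i j) => //; split.
      by move: Fi; exact/subsetPset/ndF/leq_maxl.
    by move: Gj; exact/subsetPset/ndG/leq_maxr.
  move=> k; have [mFk Fkoo] := Foo k; have [mGk Gkoo] := Goo k; split.
    rewrite -[X in measurable X]setTI; apply: measurable_rV_uncons => //.
    exact: measurableX.
  rewrite /= /pushforward -comp_preimage (_ : _ \o _ = idfun).
    by rewrite preimage_id /mu product_measure1E// lte_mul_pinfty// ge0_fin_numE.
  by apply/funext => p /=; rewrite rV_consK.
pose sm : {sigma_finite_measure set 'rV[R]_n.+1 -> \bar R} :=
  HB.pack (Measure.sort nm) (isSigmaFinite.Build _ _ _ (Measure.sort nm) sf)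
    (isSFinite.Build _ _ _ (Measure.sort nm) (sfinite_measure_sigma_finite sf)).
by exists sm; rewrite -nuE.
Qed.

Let lebesgue_rV0 n : @lebesgue_rV n set0 = 0%E.
Proof. by have [m <-] := lebesgue_rV_spec n; exact: measure0. Qed.

Let lebesgue_rV_ge0 n A : (0 <= @lebesgue_rV n A)%E.
Proof. by have [m <-] := lebesgue_rV_spec n; exact: measure_ge0. Qed.

Let lebesgue_rV_sigma_additive n : semi_sigma_additive (@lebesgue_rV n).
Proof.
by have [m <-] := lebesgue_rV_spec n; exact: measure_semi_sigma_additive.
Qed.

HB.instance Definition _ n := isMeasure.Build _ _ _ (@lebesgue_rV n)
  (@lebesgue_rV0 n) (@lebesgue_rV_ge0 n) (@lebesgue_rV_sigma_additive n).

Let lebesgue_rV_sigma_finite n : sigma_finite setT (@lebesgue_rV n).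
Proof. by have [m <-] := lebesgue_rV_spec n; exact: sigma_finiteT. Qed.

HB.instance Definition _ n := Measure_isSigmaFinite.Build _ _ _ (@lebesgue_rV n)
  (@lebesgue_rV_sigma_finite n).

Lemma measurable_box n (A : 'I_n -> set R) : (forall i, measurable (A i)) ->
  measurable [set x : 'rV[R]_n | forall i, A i (x ord0 i)].
Proof.
move=> mA.
rewrite (_ : [set _ | _] =
    \bigcap_(i in [set: 'I_n]) ((fun x : 'rV[R]_n => x ord0 i) @^-1` A i)).
  apply: fin_bigcap_measurable => // i _.
  by rewrite -[X in measurable X]setTI; exact: measurable_coord.
by apply/seteqP; split=> x /= Ax i => [_|]; exact: Ax.
Qed.

Lemma lebesgue_rV_box n (A : 'I_n -> set R) : (forall i, measurable (A i)) ->
  lebesgue_rV [set x : 'rV[R]_n | forall i, A i (x ord0 i)] =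
  (\prod_(i < n) lebesgue_measure (A i))%E.
Proof.
elim: n A => [|n IHn] A mA.
  by rewrite big_ord0 /= diracE mem_set// => -[].
rewrite big_ord_recl -IHn; last by move=> i; exact: mA.
rewrite -product_measure1E; [|exact: mA|exact: (measurable_box (fun i => mA (lift ord0 i)))].
rewrite /= /pushforward; congr product_measure1.
apply/seteqP; split=> [[a x]|[a x]] /=.
  move=> H; split=> [|i]; first by have := H ord0; rewrite rV_cons0.
  by have := H (lift ord0 i); rewrite rV_consS.
move=> [/= H0 H] i; case: (unliftP ord0 i) => [j|] ->; first by rewrite rV_consS.
by rewrite rV_cons0.
Qed.

Lemma open_measurable_rV n (A : set 'rV[R]_n) : open A -> measurable A.
Proof.
move=> oA.
pose box (p : 'rV[rat]_n * 'rV[rat]_n) := [set x : 'rV[R]_n |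
  forall i, x ord0 i \in `]ratr (p.1 ord0 i), ratr (p.2 ord0 i)[ ].
rewrite (_ : A = \bigcup_(p in [set p | box p `<=` A]) box p).
  rewrite bigcup_mkcond; apply: countable_bigcupT_measurable => // p.
  case: ifPn => // _; apply: (@measurable_box n (fun i => [set` _])) => i.
  exact: measurable_itv.
apply/seteqP; split=> [x Ax|x [p pA /pA//]].
have [B nB BA] : nbhs x A by exact: open_nbhs_nbhs.
have /choice[p pP] (i : 'I_n) : exists q : rat * rat,
    (x ord0 i \in `]ratr q.1, ratr q.2[) /\
    [set` `]ratr q.1, ratr q.2[ ] `<=` B ord0 i.
  have /nbhs_ballP[e /= e0 eB] := nB ord0 i.
  have [a /itvP ha] : exists a : rat, ratr a \in `](x ord0 i - e), (x ord0 i)[.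
    by apply: rat_in_itvoo; rewrite ltrBlDr ltrDl.
  have [b /itvP hb] : exists b : rat, ratr b \in `](x ord0 i), (x ord0 i + e)[.
    by apply: rat_in_itvoo; rewrite ltrDl.
  exists (a, b); split; first by rewrite in_itv/= ha hb.
  move=> y /= /itvP hy; apply: eB; rewrite /ball/= ltr_distlC.
  by rewrite (lt_trans _ (_ : ratr a < y)) ?ha ?hy// (lt_trans (_ : y < ratr b)) ?hb ?hy.
exists (\row_i (p i).1, \row_i (p i).2).
  move=> y yp; apply: BA => i j; rewrite (ord1 i).
  by apply: (pP j).2; have := yp j; rewrite !mxE.
by move=> i; rewrite !mxE; exact: (pP i).1.
Qed.

End lebesgue_rV.

Arguments lebesgue_rV {R n} _.


Definition enorm {R : realType} n (x : 'rV[R]_n) : R :=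
  Num.sqrt (\sum_i x ord0 i ^+ 2).

Definition eball {R : realType} n (a : 'rV[R]_n) (r : R) : set 'rV[R]_n :=
  [set x | enorm (x - a) < r].

Definition boundary {T : topologicalType} (A : set T) : set T :=
  closure A `\` interior A.

(* The dimension is n.+1, so that it is positive. The functions nu and k are total,
   but their values at 0, resp. on the diagonal, are unconstrained and never matter:
   0 is removed from the domain of integration, or the integrand vanishes there.
   L2 D is L^2(D), wL2 D w is L^2(D, w dx), Hspace nu D is H_nu(D),
   Vspace nu Omega is V_nu(Omega|R^d) and Vperp its mean-zero subspace; the names in
   -sq are squared (semi)norms in [0, +oo]. *)
Section nonlocal.
Context {R : realType} (n : nat).
Local Notation E := 'rV[R]_n.+1.
Local Notation mu := (@lebesgue_rV R n.+1).
Implicit Types (Omega B D : set E) (nu w u v f g : E -> R) (k : E -> E -> R).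

Definition levy_density nu : Prop :=
  [/\ measurable_fun ([set~ 0] : set E) nu,
      forall h, h != 0 -> 0 <= nu h,
      forall h, h != 0 -> nu h = nu (- h) &
      (\int[mu]_(h in [set~ 0%R])
         (Num.min 1 (enorm h ^+ 2) * nu h)%:E < +oo)%E].

Definition density_support nu : set E :=
  [set x | forall U : set E, open U -> U x ->
     (0 < \int[mu]_(h in U `\ 0%R) (nu h)%:E)%E].

Definition full_support nu : Prop := density_support nu = setT.

Definition radial nu : Prop :=
  forall x y, x != 0 -> y != 0 -> enorm x = enorm y -> nu x = nu y.

Definition unimodal nu : Prop :=
  radial nu /\
  exists2 c, 1 <= c & forall x y, x != 0 -> y != 0 ->
    enorm y <= enorm x -> nu x <= c * nu y.

Definition infinite_mass nu : Prop :=
  (\int[mu]_(h in [set~ 0%R]) (nu h)%:E = +oo)%E.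

(* Near each boundary point, and after a rigid motion, Omega is the strict
   epigraph of a Lipschitz function over the last n coordinates. *)
Definition lipschitz_boundary Omega : Prop :=
  forall a, boundary Omega a ->
  exists (r L : R) (Q : 'M[R]_n.+1) (gamma : 'rV[R]_n -> R),
    [/\ 0 < r, Q *m Q^T = 1%:M,
        forall p q, `|gamma p - gamma q| <= L * enorm (p - q) &
        Omega `&` eball a r =
        [set x | let y := (x - a) *m Q in gamma (col' ord0 y) < y ord0 ord0]
          `&` eball a r].

Definition dist_to (x : E) D : \bar R :=
  ereal_inf [set (enorm (x - a))%:E | a in D].

Definition inner_region Omega (delta : R) : set E :=
  [set x | Omega x /\ (delta%:E < dist_to x (boundary Omega))%E].

Definition L2sq D u : \bar R := \int[mu]_(x in D) (u x ^+ 2)%:E.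

Definition L2 D u : Prop := measurable_fun D u /\ (L2sq D u < +oo)%E.

Definition L2norm D u : R := Num.sqrt (fine (L2sq D u)).

Definition wL2sq D w u : \bar R := \int[mu]_(x in D) (u x ^+ 2 * w x)%:E.

Definition wL2 D w u : Prop := measurable_fun D u /\ (wL2sq D w u < +oo)%E.

Definition wL2norm D w u : R := Num.sqrt (fine (wL2sq D w u)).

Definition Hsemisq nu D u : \bar R :=
  \int[(mu \x mu)%E]_(z in D `*` D)
    ((u z.1 - u z.2) ^+ 2 * nu (z.1 - z.2))%:E.

Definition Hspace nu D u : Prop := L2 D u /\ (Hsemisq nu D u < +oo)%E.

Definition Hnorm nu D u : R :=
  Num.sqrt (fine (L2sq D u) + fine (Hsemisq nu D u)).

(* In the classes below, Omega is understood to be open and bounded and nu to be a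
   levy_density. The classes A1, A2, A3 require infinite mass on top of these
   standing assumptions, and not on top of A0. *)
Definition class_A0 nu : Prop := full_support nu /\ unimodal nu.

(* The second clause makes Ext a map of a.e. classes; Ext need not be linear. *)
Definition class_A1 nu Omega : Prop :=
  infinite_mass nu /\
  exists (Ext : (E -> R) -> (E -> R)) (C : R),
    [/\ 0 < C,
        forall u v, Hspace nu Omega u -> Hspace nu Omega v ->
          u = v %[ae mu in Omega] -> Ext u = Ext v %[ae mu] &
        forall u, Hspace nu Omega u ->
          [/\ Hspace nu setT (Ext u), Ext u = u %[ae mu in Omega] &
              Hnorm nu setT (Ext u) <= C * Hnorm nu Omega u]].

Definition class_A2 nu Omega : Prop :=
  [/\ infinite_mass nu, lipschitz_boundary Omega, radial nu &
      ((delta ^- 2)%:E * \int[mu]_(h in eball 0%R delta `\ 0%R)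
         (enorm h ^+ 2 * nu h)%:E)%E @[delta --> 0^'+] --> +oo%E].

Definition class_A3 nu Omega : Prop :=
  infinite_mass nu /\
  ereal_inf [set (\int[mu]_(h in inner_region Omega delta) (nu (h - a))%:E)%E |
             a in boundary Omega] @[delta --> 0^'+] --> +oo%E.

Definition Vsemisq nu Omega u : \bar R :=
  \int[mu]_(x in Omega) \int[mu]_y ((u x - u y) ^+ 2 * nu (x - y))%:E.

Definition Vspace nu Omega u : Prop :=
  [/\ measurable_fun setT u, (L2sq Omega u < +oo)%E &
      (Vsemisq nu Omega u < +oo)%E].

Definition Vnorm nu Omega u : R :=
  Num.sqrt (fine (L2sq Omega u) + fine (Vsemisq nu Omega u)).

Definition Vperp nu Omega u : Prop :=
  Vspace nu Omega u /\ \int[mu]_(x in Omega) u x = 0.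

Definition mean Omega u : R :=
  (fine (mu Omega))^-1 * \int[mu]_(x in Omega) u x.

Definition nu_tilde nu B (x : E) : R :=
  \int[mu]_(y in B) Num.min 1 (nu (x - y)).

Definition elliptic_kernel nu (Lambda : R) k : Prop :=
  [/\ measurable_fun [set z : E * E | z.1 != z.2] (fun z => k z.1 z.2),
      forall x y, x != y -> 0 <= k x y,
      forall x y, x != y -> k x y = k y x &
      forall x y, x != y ->
        Lambda^-1 * nu (y - x) <= k x y <= Lambda * nu (y - x)].

Definition energy k Omega u v : R :=
  2^-1 * \int[(mu \x mu)%E]_(z in ~` (~` Omega `*` ~` Omega))
           ((u z.1 - u z.2) * (v z.1 - v z.2) * k z.1 z.2).

(* X is both the solution space and the space of test functions. *)
Definition weak_solution (X : (E -> R) -> Prop) k Omega f g u : Prop :=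
  X u /\ forall v, X v ->
    energy k Omega u v = \int[mu]_(x in Omega) (f x * v x) +
                         \int[mu]_(y in ~` Omega) (g y * v y).

End nonlocal.

(* Main.v *)
Require Import Defs.
From mathcomp Require Import all_boot all_order all_algebra.
From mathcomp Require Import all_classical all_reals all_analysis.
From mathcomp Require Import measurable_realfun.
From mathcomp Require Import ring lra.

Set Implicit Arguments.
Unset Strict Implicit.
Unset Printing Implicit Defensive.

Import Order.TTheory GRing.Theory Num.Theory.
Import numFieldNormedType.Exports.

Local Open Scope classical_set_scope.
Local Open Scope ring_scope.

(** Among the mean-zero functions the solution is given by the Riesz representation
    theorem, with the energy as scalar product. This rests on two estimates by the
    seminorm: the Poincare inequality in [Omega], and a bound for the values outside
    [Omega] in the weight [nu_tilde]. The problem tested with all functions reduces to it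
    as constants have no energy: testing with 1 gives the compatibility condition, and
    under this condition every test function may be replaced by its mean-zero part.

    The Poincare inequality ([nonlocal_poincare]) is proved directly for the truncated
    density [j = min (1, nu)]. Let [G u x] be the integral over all [y] in the space of
    [(u x - u y) ^+ 2 * j (y - x)]; its integral over [Omega] is at most the seminorm.
    For [x] and [z] in [Omega], integrate
    [(u x - u z) ^+ 2 <= 2 * (u x - u y) ^+ 2 + 2 * (u y - u z) ^+ 2] against
    [j (y - x) * j (y - z)] over all [y]. On the left this produces the autocorrelation
    of [j] at [x - z], which by the theorem of Steinhaus ([steinhaus],
    [autocorrelation_pos]) is bounded below as long as [x - z] is small; on the right it
    costs [2 * (G u x + G u z)]. So [G] controls the oscillation of [u] at short range
    ([local_oscillation]). As [nu] has full support, the mass of the jumps from a point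
    of a bounded set into a fixed ball is bounded below ([reach_lower_bound]), hence
    every point of [Omega] is compared with the points of one small ball in two steps
    ([oscillation_bound]), and integration gives the inequality. The intermediate point
    [y] may range over the whole space because the seminorm counts the jumps which leave
    [Omega].

    The exterior bound ([exterior_le]) compares [u y] with the values of [u] in [B],
    averaged over the jumps from [B]. It makes the functional given by [f] and [g]
    continuous ([load_bound]). It also yields completeness ([Vperp_complete]): the weight
    is positive everywhere, so a Cauchy sequence has a subsequence which converges almost
    everywhere in the space, and the lemma of Fatou applies to the seminorm. The
    representation theorem ([riesz_representation]) is obtained by minimising the energy
    functional. *)

(** * Lebesgue measure: translations and bounded sets *)

Section lebesgue_translation.
Context {R : realType}.

Lemma measurable_addr_R (h : R) :
  measurable_fun setT (fun x : measurableTypeR R => x + h : measurableTypeR R).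
Proof. exact: measurable_funD. Qed.

Lemma lebesgue_measure_translate (h : R) (A : set (measurableTypeR R)) :
  measurable A ->
  lebesgue_measure ((fun x => x + h) @^-1` A) = lebesgue_measure A.
Proof.
move=> mA.
pose m : {measure set (measurableTypeR R) -> \bar R} :=
  measure_function_pushforward__canonical__measure_function_Measure
    (@lebesgue_measure R) (measurable_addr_R h).
rewrite [RHS](@lebesgue_measure_unique R m) // => X [[a b] _ <-] /=.
rewrite /pushforward (_ : _ @^-1` _ = `]a - h, b - h]%classic); last first.
  by apply/seteqP; split=> x /=; rewrite !in_itv /= ltrBlDr lerBrDr.
rewrite !lebesgue_measure_itv /= !lte_fin ltrD2r.
by case: ifPn => // _; rewrite -!EFinB; congr EFin; rewrite opprB addrA subrK.
Qed.

Lemma ge0_integral_translate_R (h : R) (f : R -> \bar R) :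
  measurable_fun setT (f : measurableTypeR R -> \bar R) -> (forall x, 0 <= f x)%E ->
  (\int[lebesgue_measure]_x f (x + h)%R = \int[lebesgue_measure]_x f x)%E.
Proof.
move=> mf f0.
rewrite [RHS](eq_measure_integral
  (measure_function_pushforward__canonical__measure_function_Measure
    lebesgue_measure (measurable_addr_R h))); last first.
  by move=> A mA _; exact/esym/lebesgue_measure_translate.
rewrite (ge0_integral_pushforward (measurable_addr_R h)) ?preimage_setT //.
Qed.

Lemma measurable_addr_rV n (h : 'rV[R]_n) : measurable_fun setT (fun x : 'rV[R]_n => x + h).
Proof.
apply/measurable_fun_rVP => i.
under eq_fun do rewrite mxE.
by apply: measurable_funD => //; exact: measurable_coord.
Qed.

(** By induction on the dimension: a measure is the integral of the measures of the
    slices, and the slice over [a] of the translated set is a translate of the slice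
    of [A] over [a + h_0]. *)
Lemma lebesgue_rV_translate n (h : 'rV[R]_n) (A : set 'rV[R]_n) :
  measurable A -> lebesgue_rV ((fun x => x + h) @^-1` A) = lebesgue_rV A.
Proof.
elim: n h A => [|n IHn] h A mA.
  congr lebesgue_rV; apply/seteqP.
  by split=> x /=; rewrite (_ : x + h = x) // thinmx0 [RHS]thinmx0.
have mcA : measurable (@rV_cons R n @^-1` A).
  by rewrite -[X in measurable X]setTI; apply: measurable_rV_cons.
have [m mE] := @lebesgue_rV_spec R n.
rewrite /= /pushforward /product_measure1.
pose phi a := (lebesgue_rV \o xsection (@rV_cons R n @^-1` A)) a.
transitivity (\int[lebesgue_measure]_a phi (a + h ord0 ord0)%R)%E.
  apply: eq_integral => a _; rewrite /phi /=.
  pose h' := \row_j h ord0 (lift ord0 j).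
  rewrite -[RHS](IHn h'); last exact: measurable_xsection.
  congr lebesgue_rV; apply/seteqP.
  have eqc (x : 'rV[R]_n) : rV_cons (a, x) + h = rV_cons (a + h ord0 ord0, x + h').
    apply/rowP => i; rewrite [LHS]mxE; case: (unliftP ord0 i) => [j|] ->.
      by rewrite !rV_consS !mxE.
    by rewrite !rV_cons0.
  by split=> x /=; rewrite /xsection /= !inE /= eqc.
apply: (@ge0_integral_translate_R (h ord0 ord0) phi).
  exact: measurable_fun_xsection.
by move=> x; exact: measure_ge0.
Qed.

Lemma ge0_integral_translate n (h : 'rV[R]_n) (f : 'rV[R]_n -> \bar R) :
  measurable_fun setT f -> (forall x, 0 <= f x)%E ->
  (\int[lebesgue_rV]_x f (x + h)%R = \int[lebesgue_rV]_x f x)%E.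
Proof.
move=> mf f0.
rewrite [RHS](eq_measure_integral
  (measure_function_pushforward__canonical__measure_function_Measure
    lebesgue_rV (measurable_addr_rV h))); last first.
  by move=> A mA _; exact/esym/lebesgue_rV_translate.
rewrite (ge0_integral_pushforward (measurable_addr_rV h)) ?preimage_setT //.
Qed.

Lemma coord_le_norm n (x : 'rV[R]_n) i : `|x ord0 i| <= `|x|.
Proof.
by rewrite [leRHS]/Num.norm /= mx_normrE; apply/bigmax_geP; right => /=; exists (ord0, i).
Qed.

Lemma measurable_norm_le_rV n (M : R) : measurable [set x : 'rV[R]_n | `|x| <= M].
Proof.
have cn : continuous (fun x : 'rV[R]_n => `|x|) by move=> x; exact: norm_continuous.
rewrite (_ : [set _ | _] = ~` ((fun x : 'rV[R]_n => `|x|) @^-1` [set y : R | M < y])).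
  apply: measurableC; apply: open_measurable_rV.
  by apply: open_comp; [move=> x _; exact: cn|exact: open_gt].
by apply/seteqP; split=> x /=; rewrite leNgt => /negP.
Qed.

Lemma lebesgue_rV_bounded n (M : R) :
  (lebesgue_rV [set x : 'rV[R]_n | (`|x| <= M)%R] < +oo)%E.
Proof.
pose A (i : 'I_n) := (`[- M, M]%classic : set (measurableTypeR R)).
have mA i : measurable (A i) by exact: measurable_itv.
apply: (@le_lt_trans _ _ (lebesgue_rV [set x : 'rV[R]_n | forall i, A i (x ord0 i)])).
  apply: le_measure; rewrite ?inE; last 1 first.
  - by move=> x /= xM i; rewrite /A /= in_itv /= -ler_norml (le_trans (coord_le_norm x i)).
  - apply: measurable_norm_le_rV.
  - exact: measurable_box.
rewrite lebesgue_rV_box // (eq_bigr (fun=> (if - M < M then M - - M else 0)%:E)) //=.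
  by rewrite prodEFin ltry.
move=> i _; rewrite lebesgue_measure_itv /= lte_fin.
by case: ifP.
Qed.

Lemma lebesgue_rV_set1 n (a : 'rV[R]_n.+1) : lebesgue_rV [set a] = 0%E.
Proof.
pose A (i : 'I_n.+1) : set (measurableTypeR R) := [set a ord0 i].
rewrite (_ : [set a] = [set x | forall i, A i (x ord0 i)]); last first.
  by apply/seteqP; split=> [x /= -> //|x /= xA]; apply/rowP => i; exact: xA.
rewrite lebesgue_rV_box; last by move=> i; exact: measurable_set1.
by rewrite big_ord_recl lebesgue_measure_set1 mul0e.
Qed.

End lebesgue_translation.

(** * Regularity of finite Borel measures and the theorem of Steinhaus *)

Section regularity.
Context {R : realType}.

Lemma exists_small_tail d (T : measurableType d) (mu : {measure set T -> \bar R})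
    (D : (set T)^nat) (e : R) :
  0 < e -> (mu (D 0%N) < +oo)%E -> (forall k, measurable (D k)) ->
  nonincreasing_seq D -> \bigcap_k D k = set0 -> exists k, (mu (D k) < e%:E)%E.
Proof.
move=> e0 fin mD niD cap0.
have := nonincreasing_cvg_mu fin mD _ niD; rewrite cap0 measure0 => /(_ measurable0) cv.
have : \forall k \near \oo, (mu (D k) < e%:E)%E.
  have := cv; move/(_ [set y | (y < e%:E)%E]) => /=; apply.
  by apply: open_nbhs_nbhs; split; [exact: open_ereal_lt_ereal|rewrite /= lte_fin].
by case=> N _ /(_ N (leqnn _)) ?; exists N.
Qed.

(** The points at distance at least [1 / (k + 1)] from the complement of [U]; they
    exhaust an open [U] by closed sets. *)
Definition erosion n (U : set 'rV[R]_n) (k : nat) : set 'rV[R]_n :=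
  [set x | ball x k.+1%:R^-1 `<=` U].

Lemma closed_erosion n (U : set 'rV[R]_n) k : closed (erosion U k).
Proof.
rewrite -openC (_ : ~` _ = \bigcup_(z in ~` U) ball z k.+1%:R^-1).
  by apply: bigcup_open => z _; apply: ball_open; rewrite invr_gt0.
apply/seteqP; split=> x /=.
  move=> nxU; apply: contrapT => H; apply: nxU => z xz.
  by apply: contrapT => Uz; apply: H; exists z => //; exact: ball_sym.
by move=> [z Uz xz] xU; apply: Uz; apply: xU; exact: ball_sym.
Qed.

Lemma erosion_sub n (U : set 'rV[R]_n) k : erosion U k `<=` U.
Proof. by move=> x; apply; apply: ballxx; rewrite invr_gt0. Qed.

Lemma nondecreasing_erosion n (U : set 'rV[R]_n) : nondecreasing_seq (erosion U).
Proof.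
move=> i j ij; apply/subsetPset => x xU; apply: subset_trans xU.
by apply: le_ball; rewrite lef_pV2 ?posrE // ler_nat.
Qed.

Lemma bigcup_erosion n (U : set 'rV[R]_n) : open U -> \bigcup_k erosion U k = U.
Proof.
move=> oU; apply/seteqP; split=> [x [k _]|x Ux]; first exact: erosion_sub.
have /nbhs_ballP[e /= e0 eU] : nbhs x U by exact: open_nbhs_nbhs.
exists (Num.truncn e^-1) => //; apply: subset_trans eU; apply: le_ball.
rewrite invf_ple ?posrE //; exact/ltW/truncnS_gt.
Qed.

Lemma closed_measurable_rV n (F : set 'rV[R]_n) : closed F -> measurable F.
Proof. by rewrite -openC -[X in measurable X]setCK => /open_measurable_rV/measurableC. Qed.

Lemma measurable_erosion n (U : set 'rV[R]_n) k : measurable (erosion U k).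
Proof. exact: (closed_measurable_rV (@closed_erosion _ U k)). Qed.

Section finite_measure.
Variables (n : nat) (mu : {measure set 'rV[R]_n -> \bar R}).
Hypothesis mufin : (mu setT < +oo)%E.

Let muoo (A : set 'rV[R]_n) : measurable A -> (mu A < +oo)%E.
Proof. by move=> mA; apply: le_lt_trans mufin; apply: le_measure; rewrite ?inE. Qed.

Definition regular_set (A : set 'rV[R]_n) := forall e : R, 0 < e ->
  exists U F, [/\ open U, closed F, F `<=` A, A `<=` U & (mu (U `\` F) < e%:E)%E].

Lemma regular_open (U : set 'rV[R]_n) : open U -> regular_set U.
Proof.
move=> oU e e0.
have [k ke] : exists k, (mu (U `\` erosion U k) < e%:E)%E.
  apply: exists_small_tail => //.
  - by apply/muoo/measurableD; [exact: open_measurable_rV|exact: measurable_erosion].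
  - move=> k; apply: measurableD; [exact: open_measurable_rV|exact: measurable_erosion].
  - move=> i j ij; apply/subsetPset => x [Ux nx]; split=> // xi; apply: nx.
    by move: xi; apply/subsetPset/nondecreasing_erosion.
  - apply/seteqP; split=> // x H; have [Ux _] := H 0%N I.
    have : (\bigcup_k erosion U k) x by rewrite bigcup_erosion.
    by move=> [k _ xk]; have [_] := H k I.
exists U, (erosion U k); split => //; [exact: closed_erosion|exact: erosion_sub].
Qed.

(** The only point which needs care is the inner approximation of a countable union:
    finitely many of the closed sets are kept, at the cost of a tail whose measure
    tends to zero because the total measure is finite. *)
Lemma sigma_algebra_regular : sigma_algebra setT regular_set.
Proof.
split.
- exact/regular_open/open0.
- move=> A rA e /rA[U [F [oU cF FA AU le]]]; exists (~` F), (~` U); split.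
  + by rewrite openC.
  + by rewrite closedC.
  + by rewrite setTD; exact: subsetC.
  + by rewrite setTD; exact: subsetC.
  + by rewrite setDE setCK setIC -setDE.
- move=> A rA e e0.
  have e2 k : 0 < e / 2 / (2 ^ k.+1)%:R.
    by rewrite !divr_gt0 // ltr0n expn_gt0.
  have /choice[U /choice[F UF]] k := rA k _ (e2 k).
  pose FN N := \bigcup_(k < N) F k.
  have cFN N : closed (FN N).
    by apply: closed_bigcup => [|k _]; [exact: finite_II|have [] := UF k].
  have mFN N : measurable (FN N) := closed_measurable_rV (cFN N).
  have oU : open (\bigcup_k U k) by apply: bigcup_open => k _; have [] := UF k.
  have mU k : measurable (U k) by apply: open_measurable_rV; have [] := UF k.
  have mF k : measurable (F k) by apply: closed_measurable_rV; have [] := UF k.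
  have mUF : measurable (\bigcup_k U k `\` \bigcup_k F k).
    by apply: measurableD; exact: bigcupT_measurable.
  have small : (mu (\bigcup_k U k `\` \bigcup_k F k) <= (e / 2)%:E)%E.
    apply: (@le_trans _ _ (\sum_(k <oo) mu (U k `\` F k))%E).
      apply: measure_sigma_subadditive => //.
        by move=> k; exact: measurableD.
      by move=> x [[k _ Uk] nF]; exists k => //; split=> // Fk; apply: nF; exists k.
    apply: (@le_trans _ _ (\sum_(k <oo) (e / 2 / (2 ^ k.+1)%:R)%:E)%E).
      by apply: lee_nneseries => // k _; apply: ltW; have [] := UF k.
    by apply: epsilon_trick0; rewrite ltW // divr_gt0.
  have [N Ne] : exists N, (mu (\bigcup_k F k `\` FN N) < (e / 2)%:E)%E.
    apply: exists_small_tail.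
    + by rewrite divr_gt0.
    + apply: muoo; apply: measurableD; first exact: bigcupT_measurable.
      exact: mFN.
    + move=> k; apply: measurableD; first exact: bigcupT_measurable.
      exact: mFN.
    + move=> i j ij; apply/subsetPset => x [Fx nx]; split=> // -[k /= ki Fk].
      by apply: nx; exists k => //=; exact: leq_trans ij.
    + apply/seteqP; split=> // x H; have [[k _ Fk] _] := H 0%N I.
      by have [_] := H k.+1 I; apply; exists k => /=.
  exists (\bigcup_k U k), (FN N); split => //.
  + by move=> x [k _ Fk]; exists k => //; have [_ _ + _ _] := UF k; apply.
  + by move=> x [k _ Ak]; exists k => //; have [_ _ _ + _] := UF k; apply.
  + rewrite [e]splitr EFinD.
    have mD2 : measurable (\bigcup_k F k `\` FN N).
      by apply: measurableD; [exact: bigcupT_measurable|exact: mFN].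
    apply: le_lt_trans (lee_ltD _ small Ne) => //.
      apply: le_trans (measureU2 _ mUF mD2); apply: le_measure; rewrite ?inE //.
      * by apply: measurableD; [exact: bigcupT_measurable|exact: mFN].
      * exact: measurableU.
      * by move=> x [Ux nx]; case: (pselect ((\bigcup_k F k) x)) => Fx; [right|left].
    by rewrite ge0_fin_numE //; exact: muoo.
Qed.

(** Borel sets of the line pull back to regular sets under a coordinate because open
    intervals do, and such preimages generate the Borel sets of the space. *)
Lemma regular_measurable (A : set 'rV[R]_n) : measurable A -> regular_set A.
Proof.
apply: smallest_sub; first exact: sigma_algebra_regular.
move=> _ [i _ [Y mY <-]].
have sC := sigma_algebra_image (fun x : 'rV[R]_n => x ord0 i) sigma_algebra_regular.
suff : image_set_system setT (fun x : 'rV[R]_n => x ord0 i) regular_set Y by [].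
have : (RGenOpens.G (R:=R)).-sigma.-measurable Y by rewrite -RGenOpens.measurableE.
apply: smallest_sub => // _ [x [y ->]]; rewrite /image_set_system /= setTI.
apply: regular_open; apply: open_comp => [z _|]; first exact: coord_continuous.
exact: itv_open.
Qed.

End finite_measure.

Local Notation leb := lebesgue_rV.

(** Restricting Lebesgue measure to a ball around [A] makes it finite. *)
Lemma lebesgue_rV_outer_regular n (A : set 'rV[R]_n) (M e : R) :
  measurable A -> A `<=` [set x | `|x| <= M] -> 0 < e ->
  exists U, [/\ open U, A `<=` U, (leb U < +oo)%E & (leb (U `\` A) < e%:E)%E].
Proof.
move=> mA AM e0.
pose D : set 'rV[R]_n := [set x | `|x| <= M + 1].
have mD : measurable D by exact: measurable_norm_le_rV.
pose mu : {measure set 'rV[R]_n -> \bar R} := mrestr leb mD.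
have muT : (mu setT < +oo)%E by rewrite /mu /= /mrestr setTI; exact: lebesgue_rV_bounded.
have [U [F [oU cF FA AU le]]] := regular_measurable muT mA e0.
pose V := U `&` [set x | `|x| < M + 1].
have cn : continuous (fun x : 'rV[R]_n => `|x|) by move=> x; exact: norm_continuous.
have oV : open V.
  apply: openI => //; apply: (@open_comp _ _ (fun x : 'rV[R]_n => `|x|) [set y | y < M + 1]).
    by move=> x _; exact: cn.
  exact: open_lt.
have mV := open_measurable_rV oV.
exists V; split => //.
- by move=> x Ax; split; [exact: AU|rewrite /= (le_lt_trans (AM _ Ax)) // ltrDl].
- apply: le_lt_trans (lebesgue_rV_bounded _ (M + 1)).
  by apply: le_measure; rewrite ?inE //; move=> x [_ /ltW].
- apply: le_lt_trans le; rewrite /mu /= /mrestr.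
  apply: le_measure; rewrite ?inE.
  + exact: measurableD.
  + apply: measurableI => //; apply: measurableD; first exact: open_measurable_rV.
    exact: closed_measurable_rV.
  + by move=> x [[Ux /ltW xM] nA]; split=> //; split=> // Fx; apply: nA; exact: FA.
Qed.

(** The theorem of Steinhaus with a quantitative conclusion. Take an open [U]
    containing [A] with little excess, and the part [X] of [A] which stays in [U]
    under all small translations: [X] and its translates all fill most of [U], so
    they overlap. *)
Lemma steinhaus n (A : set 'rV[R]_n) (M : R) :
  measurable A -> A `<=` [set x | `|x| <= M] -> (0 < leb A)%E ->
  exists r c : R, [/\ 0 < r, 0 < c & forall h : 'rV[R]_n, `|h| < r ->
    (c%:E <= leb (A `&` (fun w => (w + h)%R) @^-1` A))%E].
Proof.
move=> mA AM A0.
have Aoo : (leb A < +oo)%E.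
  apply: le_lt_trans (lebesgue_rV_bounded n M); apply: le_measure; rewrite ?inE //.
  exact: measurable_norm_le_rV.
pose a := fine (leb A).
have aE : leb A = a%:E by rewrite fineK // ge0_fin_numE.
have a0 : 0 < a by rewrite fine_gt0 // A0.
have a8 : 0 < a / 8 by rewrite divr_gt0.
have [U [oU AU Uoo Ua]] := lebesgue_rV_outer_regular mA AM a8.
have mU := open_measurable_rV oU.
have [k ka] : exists k, (leb (A `\` erosion U k) < (a / 8)%:E)%E.
  apply: exists_small_tail => //.
  - apply: le_lt_trans Aoo; apply: le_measure; rewrite ?inE //.
    by apply: measurableD => //; exact: measurable_erosion.
  - by move=> k; apply: measurableD => //; exact: measurable_erosion.
  - move=> i j ij; apply/subsetPset => x [Ax nx]; split=> // xi; apply: nx.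
    by move: xi; apply/subsetPset/nondecreasing_erosion.
  - apply/seteqP; split=> // x H; have [Ax _] := H 0%N I.
    have : (\bigcup_k erosion U k) x by rewrite bigcup_erosion //; exact: AU.
    by move=> [k _ xk]; have [_] := H k I.
exists k.+1%:R^-1, (a / 2); split; [by rewrite invr_gt0|by rewrite divr_gt0|].
move=> h hr.
pose X := A `&` erosion U k.
have mX : measurable X by apply: measurableI => //; exact: measurable_erosion.
pose Xh := (fun w => w + h) @^-1` X.
have mXh : measurable Xh by rewrite -[X in measurable X]setTI; exact: measurable_addr_rV.
have XhU : Xh `<=` U.
  move=> w [_ wU]; apply: wU; rewrite -ball_normE /ball_ /=.
  by rewrite addrC addKr.
have XU : X `<=` U by move=> x [/AU].
have Xhm : leb Xh = leb X by exact: lebesgue_rV_translate.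
have Xoo : (leb X < +oo)%E.
  by apply: le_lt_trans Aoo; apply: le_measure; rewrite ?inE //; exact: subIsetl.
have mXX : measurable (X `&` Xh) by exact: measurableI.
apply: (@le_trans _ _ (leb (X `&` Xh))); last first.
  apply: le_measure; rewrite ?inE //.
    apply: measurableI => //.
    by rewrite -[X in measurable X]setTI; exact: measurable_addr_rV.
  by move=> w [[Aw _] [Awh _]].
have E1 : leb (X `|` Xh) = (leb X + leb Xh - leb (X `&` Xh))%E by exact: measureUfinl.
have E2 : (leb (X `|` Xh) <= leb U)%E.
  by apply: le_measure; rewrite ?inE //; [exact: measurableU|move=> x [/XU|/XhU]].
have E3 : leb A = (leb (A `\` erosion U k) + leb X)%E.
  by apply: measureDI => //; exact: measurable_erosion.
have E4 : leb U = (leb (U `\` A) + leb A)%E.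
  by rewrite {1}(measureDI _ mU mA) (_ : U `&` A = A) //; exact/setIidPr.
move: E1 E2 E3 E4; rewrite aE Xhm.
have fX : leb X \is a fin_num by rewrite ge0_fin_numE.
have fU : leb U \is a fin_num by rewrite ge0_fin_numE.
have f1 : leb (U `\` A) \is a fin_num by rewrite ge0_fin_numE // (lt_trans Ua) // ltry.
have f2 : leb (A `\` erosion U k) \is a fin_num by rewrite ge0_fin_numE // (lt_trans ka) // ltry.
have f3 : leb (X `&` Xh) \is a fin_num.
  rewrite ge0_fin_numE // (le_lt_trans _ Xoo) //.
  by apply: le_measure; rewrite ?inE //; exact: subIsetl.
move: ka Ua.
rewrite -(fineK fX) -(fineK fU) -(fineK f1) -(fineK f2) -(fineK f3).
(* the measure of X is at least 7a/8 and that of U at most 9a/8 *)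
move=> + + ->; rewrite -!EFinB -!EFinD !lee_fin !lte_fin => ? ? ? [?] [?].
lra.
Qed.

End regularity.

(** * Square integrable functions *)

Lemma discriminant_le (R : realFieldType) (A B C : R) :
  (forall a b, 0 <= a ^+ 2 * A + 2 * a * b * B + b ^+ 2 * C) -> B ^+ 2 <= A * C.
Proof.
move=> H.
have A0 : 0 <= A by have := H 1 0; rewrite expr1n expr0n /=; lra.
have : 0 <= C by have := H 0 1; rewrite expr1n expr0n /=; lra.
rewrite le_eqVlt => /orP[/eqP C0|C0].
  (* the form is then linear in its second argument, which forces B = 0 *)
  have := H (- B) (1 + A); rewrite -C0 => h.
  have h3 : 0 <= - (2 + A) * B ^+ 2 by nra.
  have := sqr_ge0 B; nra.
have := H C (- B).
have -> : C ^+ 2 * A + 2 * C * - B * B + (- B) ^+ 2 * C = C * (A * C - B ^+ 2) by ring.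
by rewrite pmulr_rge0 // subr_ge0.
Qed.

Section square_integrable.
Context d (T : measurableType d) (R : realType) (m : {measure set T -> \bar R}).
Implicit Types f g h : T -> R.

Definition sqnorm f : \bar R := \int[m]_x (f x ^+ 2)%:E.

Definition sqint f : Prop := measurable_fun setT f /\ (sqnorm f < +oo)%E.

Definition ip f g : R := \int[m]_x (f x * g x).

Lemma sqnorm_ge0 f : (0 <= sqnorm f)%E.
Proof. by apply: integral_ge0 => x _; rewrite lee_fin sqr_ge0. Qed.

Lemma measurable_sqr f : measurable_fun setT f ->
  measurable_fun setT (fun x => (f x ^+ 2)%:E).
Proof. by move=> mf; apply/measurable_EFinP; exact: measurable_funX. Qed.

Lemma sqint_integrableM f g : sqint f -> sqint g ->
  m.-integrable setT (EFin \o (fun x => f x * g x)).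
Proof.
move=> [mf f2] [mg g2].
apply: (@le_integrable _ _ _ m setT measurableT _
          (fun x => (f x ^+ 2)%:E + (g x ^+ 2)%:E)%E).
- by apply/measurable_EFinP; exact: measurable_funM.
- move=> x _ /=; rewrite lee_fin [leRHS]ger0_norm ?addr_ge0 ?sqr_ge0 //.
  have := sqr_ge0 (`|f x| - `|g x|); rewrite normrM sqrrB !real_normK ?num_real //.
  have := sqr_ge0 (f x); have := sqr_ge0 (g x); lra.
- apply/integrableP; split.
    by apply: emeasurable_funD; exact: measurable_sqr.
  under eq_integral do rewrite gee0_abs ?adde_ge0 ?lee_fin ?sqr_ge0 //.
  rewrite ge0_integralD //; [exact: lte_add_pinfty|..]; try exact: measurable_sqr.
  + by move=> x _; rewrite lee_fin sqr_ge0.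
  + by move=> x _; rewrite lee_fin sqr_ge0.
Qed.

Lemma sqintD a b f g : sqint f -> sqint g -> sqint (fun x => a * f x + b * g x).
Proof.
move=> [mf f2] [mg g2].
have ml : measurable_fun setT (fun x => a * f x + b * g x).
  by apply: measurable_funD; apply: measurable_funM.
split=> //.
apply: (@le_lt_trans _ _ (\int[m]_x ((2 * a ^+ 2)%:E * (f x ^+ 2)%:E +
                                    (2 * b ^+ 2)%:E * (g x ^+ 2)%:E))%E).
  apply: ge0_le_integral => //.
  - by move=> x _; rewrite lee_fin sqr_ge0.
  - exact: measurable_sqr.
  - by apply: emeasurable_funD; apply: measurable_funeM; exact: measurable_sqr.
  - move=> x _; rewrite -!EFinM -EFinD lee_fin.
    by have := sqr_ge0 (a * f x - b * g x); rewrite sqrrB sqrrD !exprMn; lra.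
have mf2 := measurable_sqr mf; have mg2 := measurable_sqr mg.
have p0 h x : setT x -> (0 <= (h x ^+ 2 : R)%:E)%E by rewrite lee_fin sqr_ge0.
have a0 : 0 <= 2 * a ^+ 2 by rewrite mulr_ge0 ?sqr_ge0.
have b0 : 0 <= 2 * b ^+ 2 by rewrite mulr_ge0 ?sqr_ge0.
rewrite ge0_integralD //; last 4 first.
- by move=> x Tx; rewrite mule_ge0 ?p0.
- exact: measurable_funeM.
- by move=> x Tx; rewrite mule_ge0 ?p0.
- exact: measurable_funeM.
rewrite !ge0_integralZl_EFin //; try exact: p0.
by apply: lte_add_pinfty; apply: lte_mul_pinfty.
Qed.

Lemma ipC f g : ip f g = ip g f.
Proof. by rewrite /ip; apply: eq_Rintegral => x _; rewrite mulrC. Qed.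

Lemma ipDl a b f g h : sqint f -> sqint g -> sqint h ->
  ip (fun x => a * f x + b * g x) h = a * ip f h + b * ip g h.
Proof.
move=> f2 g2 h2; rewrite /ip.
have fh := sqint_integrableM f2 h2; have gh := sqint_integrableM g2 h2.
rewrite -!RintegralZl // -RintegralD //.
- by apply: eq_Rintegral => x _; rewrite mulrDl !mulrA.
- exact: (integrableZl measurableT a fh).
- exact: (integrableZl measurableT b gh).
Qed.

Lemma ip_sqnorm f : sqint f -> sqnorm f = (ip f f)%:E.
Proof.
by move=> [mf f2]; rewrite /ip /Rintegral fineK // -/(sqnorm f) ge0_fin_numE // sqnorm_ge0.
Qed.

Lemma ip_ge0 f : 0 <= ip f f.
Proof. by apply: Rintegral_ge0 => x _; rewrite -expr2 sqr_ge0. Qed.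

Lemma sqnorm_comb a b f g : sqint f -> sqint g ->
  sqnorm (fun x => a * f x + b * g x) =
    (a ^+ 2 * ip f f + 2 * a * b * ip f g + b ^+ 2 * ip g g)%:E.
Proof.
move=> f2 g2; rewrite ip_sqnorm; last exact: sqintD.
rewrite ipDl //; last exact: sqintD.
rewrite (ipC f) (ipC g (fun x => a * f x + b * g x)) !ipDl // (ipC g f).
by congr EFin; ring.
Qed.

Lemma cauchy_schwarz f g : sqint f -> sqint g -> ip f g ^+ 2 <= ip f f * ip g g.
Proof.
move=> f2 g2.
have H a b : 0 <= a ^+ 2 * ip f f + 2 * a * b * ip f g + b ^+ 2 * ip g g.
  by rewrite -lee_fin -sqnorm_comb // sqnorm_ge0.
exact: discriminant_le.
Qed.

End square_integrable.

(** * The autocorrelation of a kernel controls oscillations at short range *)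

Section short_range.
Context {R : realType} (n : nat).
Local Notation E := 'rV[R]_n.
Local Notation mu := (@lebesgue_rV R n).
Variable j : E -> R.
Hypothesis mj : measurable_fun setT j.
Hypothesis j01 : forall h, 0 <= j h <= 1.
Hypothesis j_open : forall U : set E, open U -> U !=set0 ->
  (0 < \int[mu]_(h in U) (j h)%:E)%E.

Let j0 h : 0 <= j h. Proof. by have /andP[] := j01 h. Qed.
Let j1 h : j h <= 1. Proof. by have /andP[] := j01 h. Qed.

Lemma measurable_subr_rV (a : E) : measurable_fun setT (fun y : E => y - a).
Proof. exact: measurable_addr_rV. Qed.

Lemma measurable_ball_rV (a : E) (r : R) : 0 < r -> measurable (ball a r).
Proof. by move=> r0; apply: open_measurable_rV; exact: ball_open. Qed.

Let mjs (a : E) : measurable_fun setT (fun y : E => j (y - a)).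
Proof. exact: (measurableT_comp mj (measurable_subr_rV a)). Qed.

Lemma superlevel_pos : exists e : R, 0 < e /\
  (0 < mu [set w : E | (`|w| <= 1)%R /\ (e <= j w)%R])%E.
Proof.
pose A (k : nat) := [set w : E | `|w| <= 1 /\ k.+1%:R^-1 <= j w].
have mA k : measurable (A k).
  rewrite (_ : A k = [set w | `|w| <= 1] `&` j @^-1` `[k.+1%:R^-1, +oo[).
    apply: measurableI; first exact: measurable_norm_le_rV.
    by rewrite -[X in measurable X]setTI; exact: mj.
  by apply/seteqP; split=> w /=; rewrite in_itv /= andbT.
apply: contrapT => H.
have A0 k : mu (A k) = 0%E.
  apply/eqP; rewrite -measure_le0 leNgt; apply/negP => Ak; apply: H.
  by exists k.+1%:R^-1; rewrite invr_gt0.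
have N0 : mu (\bigcup_k A k) = 0%E.
  apply/eqP; rewrite -measure_le0.
  apply: (@le_trans _ _ (\sum_(k <oo) mu (A k))%E); last by rewrite eseries0.
  by apply: measure_sigma_subadditive => //; exact: bigcupT_measurable.
have : (0 < \int[mu]_(h in ball (0%R : E) 1%R) (j h)%:E)%E.
  by apply: j_open; [exact: ball_open|exists 0; exact: ballxx].
rewrite ltNge => /negP; apply.
have mB := measurable_ball_rV 0 ltr01.
rewrite (ge0_negligible_integral (bigcupT_measurable _ mA)) //.
- rewrite integral0_eq // => w [w1 nA]; congr EFin.
  apply/eqP; rewrite eq_le j0 andbT leNgt; apply/negP => jw; apply: nA.
  exists (Num.truncn (j w)^-1) => //; split.
    by move: w1; rewrite -ball_normE /ball_ /= sub0r normrN => /ltW.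
  by rewrite invf_ple ?posrE //; exact/ltW/truncnS_gt.
- by apply/measurable_EFinP; apply: measurable_funTS.
- by move=> w _; rewrite lee_fin.
Qed.

(** The kernel is bounded below on a superlevel set, and the theorem of Steinhaus
    bounds below the overlap of this set with its small translates. *)
Lemma autocorrelation_pos : exists r c : R, [/\ 0 < r, 0 < c & forall h : E, `|h| < r ->
  (c%:E <= \int[mu]_w (j w * j (w + h))%:E)%E].
Proof.
have [e [e0 A0]] := superlevel_pos.
set A := [set w : E | _ /\ _] in A0.
have mA : measurable A.
  rewrite (_ : A = [set w | `|w| <= 1] `&` j @^-1` `[e, +oo[).
    apply: measurableI; first exact: measurable_norm_le_rV.
    by rewrite -[X in measurable X]setTI; exact: mj.
  by apply/seteqP; split=> w /=; rewrite in_itv /= andbT.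
have [|r [c [r0 c0 H]]] := steinhaus mA _ A0 (M := 1); first by move=> w [].
exists r, (e ^+ 2 * c); split => //; first by rewrite mulr_gt0 // exprn_gt0.
move=> h hr.
pose C := A `&` (fun w => w + h) @^-1` A.
have mC : measurable C.
  by apply: measurableI => //; rewrite -[X in measurable X]setTI; exact: measurable_addr_rV.
have mjj : measurable_fun setT (fun w => (j w * j (w + h))%:E).
  apply/measurable_EFinP; apply: measurable_funM => //.
  exact: (measurableT_comp mj (measurable_addr_rV h)).
apply: (@le_trans _ _ (\int[mu]_(w in C) (j w * j (w + h))%:E)%E); last first.
  by apply: ge0_subset_integral => // w _; rewrite lee_fin mulr_ge0.
apply: (@le_trans _ _ (\int[mu]_(w in C) (cst (e ^+ 2)%:E w))%E).
  rewrite integral_cst // EFinM; apply: lee_wpmul2l; last exact: H.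
  by rewrite lee_fin sqr_ge0.
apply: ge0_le_integral => //.
- by move=> w _; rewrite lee_fin sqr_ge0.
- exact: measurable_funTS.
- move=> w [[_ ew] [_ ewh]]; rewrite lee_fin expr2; apply: ler_pM => //; exact: ltW.
Qed.

(** The contribution of the point [x] to the nonlocal energy. The end point [y] of the
    jump ranges over the whole space. *)
Definition local_var (u : E -> R) (x : E) : \bar R :=
  \int[mu]_y ((u x - u y) ^+ 2 * j (y - x))%:E.

Lemma local_var_ge0 u x : (0 <= local_var u x)%E.
Proof. by apply: integral_ge0 => y _; rewrite lee_fin mulr_ge0 ?sqr_ge0. Qed.

Lemma measurable_local_integrand (u : E -> R) (x : E) : measurable_fun setT u ->
  measurable_fun setT (fun y => ((u x - u y) ^+ 2 * j (y - x))%:E).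
Proof.
move=> mfu; apply/measurable_EFinP; apply: measurable_funM => //.
by apply: measurable_funX; apply: measurable_funB.
Qed.

Lemma sqr_subr_le2 (a b c : R) : (a - c) ^+ 2 <= 2 * (a - b) ^+ 2 + 2 * (b - c) ^+ 2.
Proof. by have := sqr_ge0 ((a - b) - (b - c)); lra. Qed.

(** Go from [x] to [z] through a third point [y]. The weight
    [j (y - x) * j (y - z)] has a mass in [y] which is bounded below for [x] close to
    [z], and as [j] is at most 1 each half of the path is paid for by one end
    point. *)
Lemma local_oscillation : exists r c : R, [/\ 0 < r, 0 < c & forall (u : E -> R) (x z : E),
  measurable_fun setT u -> `|x - z| < r ->
  ((c * (u x - u z) ^+ 2)%:E <= 2%:E * (local_var u x + local_var u z))%E].
Proof.
have [r [c [r0 c0 H]]] := autocorrelation_pos.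
exists r, c; split => // u x z mfu xz.
have mjj : measurable_fun setT (fun w => (j w * j (w + (x - z)))%:E).
  apply/measurable_EFinP; apply: measurable_funM => //.
  exact: (measurableT_comp mj (measurable_addr_rV _)).
have mjj2 : measurable_fun setT (fun w : E => (j (w - x) * j (w - z))%:E).
  by apply/measurable_EFinP; exact: measurable_funM.
have : (((u x - u z) ^+ 2 * c)%:E <=
    \int[mu]_y (((u x - u z) ^+ 2)%:E * (j (y - x) * j (y - z))%:E))%E.
  rewrite ge0_integralZl_EFin ?sqr_ge0 //; last by move=> y _; rewrite lee_fin mulr_ge0.
  rewrite EFinM; apply: lee_wpmul2l; first by rewrite lee_fin sqr_ge0.
  apply: le_trans (H _ xz) _.
  rewrite -(ge0_integral_translate (- x) mjj); last by move=> y; rewrite lee_fin mulr_ge0.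
  apply: ge0_le_integral => //.
  - by move=> y _; rewrite lee_fin mulr_ge0.
  - exact: (measurableT_comp mjj (measurable_addr_rV _)).
  - by move=> y _; rewrite lee_fin addrA subrK.
move=> /le_trans K.
rewrite mulrC ge0_muleDr ?local_var_ge0 //.
  apply: K; rewrite /local_var -!ge0_integralZl_EFin //; last 4 first.
  - by move=> y _; rewrite lee_fin mulr_ge0 ?sqr_ge0.
  - exact: measurable_local_integrand.
  - by move=> y _; rewrite lee_fin mulr_ge0 ?sqr_ge0.
  - exact: measurable_local_integrand.
  rewrite -ge0_integralD //; last 4 first.
  - by move=> y _; rewrite mule_ge0 // lee_fin mulr_ge0 ?sqr_ge0.
  - by apply: measurable_funeM; exact: measurable_local_integrand.
  - by move=> y _; rewrite mule_ge0 // lee_fin mulr_ge0 ?sqr_ge0.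
  - by apply: measurable_funeM; exact: measurable_local_integrand.
  apply: ge0_le_integral => //.
  - by move=> y _; rewrite -EFinM lee_fin; apply: mulr_ge0; [exact: sqr_ge0|exact: mulr_ge0].
  - exact: measurable_funeM.
  - by apply: emeasurable_funD; apply: measurable_funeM; exact: measurable_local_integrand.
  - move=> y _; rewrite -!EFinM -EFinD lee_fin.
    apply: (@le_trans _ _ ((2 * (u x - u y) ^+ 2 + 2 * (u y - u z) ^+ 2) *
                           (j (y - x) * j (y - z)))).
      by apply: ler_wpM2r; [exact: mulr_ge0|exact: sqr_subr_le2].
    rewrite mulrDl; apply: lerD; rewrite -mulrA ler_wpM2l //.
      by apply: ler_wpM2l; [exact: sqr_ge0|rewrite ler_piMr].
    by rewrite -(opprB (u z)) sqrrN; apply: ler_wpM2l; [exact: sqr_ge0|rewrite ler_piMl].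
Qed.

End short_range.

(** * Mean-zero functions on a domain *)

Section l2_on_domain.
Context d (T : measurableType d) (R : realType) (m : {measure set T -> \bar R}).
Variables (D : set T) (mD : measurable D).

Lemma sqnorm_patch (u : T -> R) :
  (\int[m]_(x in D) (u x ^+ 2)%:E)%E = sqnorm m (u \_ D).
Proof.
rewrite integral_mkcond; apply: eq_integral => x _; rewrite /patch.
by case: ifP => // _; rewrite expr0n.
Qed.

Lemma sqint_patch (u : T -> R) : measurable_fun D u ->
  (\int[m]_(x in D) (u x ^+ 2)%:E < +oo)%E -> sqint m (u \_ D).
Proof.
by move=> mfu u2; split; [exact/(measurable_restrictT _ mD).1|rewrite -sqnorm_patch].
Qed.

Lemma ip_patch (u v : T -> R) : ip m (u \_ D) (v \_ D) = \int[m]_(x in D) (u x * v x).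
Proof.
rewrite [RHS]Rintegral_mkcond; apply: eq_Rintegral => x _; rewrite /patch.
by case: ifP => // _; rewrite mulr0.
Qed.

Lemma sqint_cst_patch (t : R) : (m D < +oo)%E -> sqint m (cst t \_ D).
Proof.
move=> Doo; apply: sqint_patch; first exact: measurable_cst.
by rewrite (eq_integral (cst (t ^+ 2)%:E)) // integral_cst // lte_mul_pinfty // lee_fin sqr_ge0.
Qed.

(** A mean-zero function is orthogonal to the constants, so that subtracting a constant
    adds its square norm. *)
Lemma sqnorm_le_sub_cst (u : T -> R) (t : R) : (m D < +oo)%E ->
  measurable_fun D u -> (\int[m]_(x in D) (u x ^+ 2)%:E < +oo)%E ->
  \int[m]_(x in D) u x = 0 ->
  (\int[m]_(x in D) (u x ^+ 2)%:E <= \int[m]_(x in D) ((u x - t) ^+ 2)%:E)%E.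
Proof.
move=> Doo mfu u2 u0.
have fu := sqint_patch mfu u2; have f1 := sqint_cst_patch 1 Doo.
rewrite !sqnorm_patch.
have -> : (fun x => u x - t) \_ D = (fun x => 1 * (u \_ D) x + (- t) * ((cst 1 : T -> R) \_ D) x).
  apply/funext => x; rewrite /patch; case: ifP => _; first by rewrite mul1r mulr1.
  by rewrite !mulr0 addr0.
rewrite sqnorm_comb // ip_sqnorm // lee_fin.
have -> : ip m (u \_ D) ((cst 1 : T -> R) \_ D) = 0.
  by rewrite ip_patch -[RHS]u0; apply: eq_Rintegral => x _; rewrite /= mulr1.
rewrite mulr0 addr0 expr1n mul1r lerDl; apply: mulr_ge0; [exact: sqr_ge0|exact: ip_ge0].
Qed.

End l2_on_domain.

(** * The nonlocal Poincare inequality *)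

Section poincare_inequality.
Context {R : realType} (n : nat).
Local Notation E := 'rV[R]_n.
Local Notation mu := (@lebesgue_rV R n).
Variable j : E -> R.
Hypothesis mj : measurable_fun setT j.
Hypothesis j01 : forall h, 0 <= j h <= 1.
Hypothesis j_open : forall U : set E, open U -> U !=set0 ->
  (0 < \int[mu]_(h in U) (j h)%:E)%E.

Let j0 h : 0 <= j h. Proof. by have /andP[] := j01 h. Qed.
Let j1 h : j h <= 1. Proof. by have /andP[] := j01 h. Qed.

Let mjs (a : E) : measurable_fun setT (fun y : E => j (y - a)).
Proof. exact: (measurableT_comp mj (measurable_subr_rV a)). Qed.

Lemma integral_cst_rV (D : set E) (t : \bar R) : measurable D ->
  (\int[mu]_(_ in D) t = t * mu D)%E.
Proof. by move=> mD; exact: integral_cst. Qed.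

Lemma exists_pos_le_ereal (q : \bar R) : (0 < q)%E -> exists2 e : R, 0 < e & (e%:E <= q)%E.
Proof.
case: q => [r r0|_|//]; first by exists r.
by exists 1 => //; rewrite leey.
Qed.

(** From a given point, the mass of the jumps into the ball is positive since [j]
    charges open sets. The concentric ball of half the radius bounds this mass below
    for all nearby points, and compactness makes the bound uniform. *)
Lemma reach_lower_bound (a0 : E) (rho M : R) : 0 < rho ->
  exists2 c : R, 0 < c & forall y : E, `|y| <= M ->
    (c%:E <= \int[mu]_(a in ball a0 rho) (j (a - y))%:E)%E.
Proof.
move=> rho0.
pose K := [set y : E | `|y| <= M].
pose p y := (\int[mu]_(a in ball a0 rho) (j (a - y))%:E)%E.
have cK : compact K.
  apply: bounded_closed_compact.
    by exists M; split; [exact: num_real|move=> x Mx y /= yM; rewrite (le_trans yM) // ltW].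
  have cn : continuous (fun x : E => `|x|) by move=> x; exact: norm_continuous.
  apply: (@closed_comp _ _ (fun x : E => `|x|) [set y | y <= M]); last exact: closed_le.
  by move=> x _; exact: cn.
have rho2 : 0 < rho / 2 by rewrite divr_gt0.
have mB a r : 0 < r -> measurable (ball a r : set E) by move=> ?; exact: measurable_ball_rV.
have mje : measurable_fun setT (EFin \o j) by exact/measurable_EFinP.
have pB (y0 y : E) : ball y0 (rho / 2) y ->
    (\int[mu]_(w in ball (a0 - y0)%R (rho / 2)%R) (j w)%:E <= p y)%E.
  move=> y0y; rewrite /p [leRHS]integral_mkcond [leLHS]integral_mkcond.
  rewrite -(@ge0_integral_translate _ _ (- y)); last 2 first.
  - by apply/(measurable_restrictT _ _).1; [exact: mB|exact: measurable_funTS].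
  - by move=> x; apply: erestrict_ge0 => w _; rewrite lee_fin.
  have mr : measurable_fun setT ((fun a => (j (a - y))%:E) \_ (ball a0 rho)).
    apply/(measurable_restrictT _ _).1; [exact: mB|apply: measurable_funTS].
    exact/measurable_EFinP.
  apply: ge0_le_integral => //.
  - by move=> x _; apply: erestrict_ge0 => w _; rewrite lee_fin.
  - apply: (@measurableT_comp _ _ _ _ _ _ (_ \_ _) _ (fun a : E => a - y)).
      by apply/(measurable_restrictT _ _).1; [exact: mB|exact: measurable_funTS].
    exact: measurable_subr_rV.
  - move=> a _; rewrite /patch; case: ifPn => [|_]; last first.
      by case: ifP => _ //; rewrite lee_fin.
    rewrite inE => ay; rewrite ifT // inE.
    have := ay; have := y0y; rewrite -!ball_normE /ball_ /= => h1 h2.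
    rewrite (_ : a0 - a = (a0 - y0 - (a - y)) + (y0 - y)); last first.
      by apply/rowP => i; rewrite !mxE; ring.
    by apply: le_lt_trans (ler_normD _ _) _; rewrite [rho]splitr ltrD.
have [k Hk] : \forall k \near \oo, K `<=` (fun y => (k.+1%:R^-1)%:E <= p y)%E.
  apply: (compact_near_coveringP K).1 => // y0 _.
  have /exists_pos_le_ereal[e e0 eq0] :
      (0 < \int[mu]_(w in ball (a0 - y0)%R (rho / 2)%R) (j w)%:E)%E.
    by apply: j_open; [exact: ball_open|exists (a0 - y0); exact: ballxx].
  exists (ball y0 (rho / 2), [set k | (Num.truncn e^-1 <= k)%N]).
    by split; [exact: nbhsx_ballx|exists (Num.truncn e^-1)].
  move=> [y k] /= [yB kN]; apply: le_trans (pB _ _ yB); apply: le_trans eq0.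
  rewrite lee_fin invf_ple ?posrE //; apply: le_trans (ltW (truncnS_gt _)) _.
  by rewrite ler_nat.
by move=> /(_ k (leqnn k)) kK; exists k.+1%:R^-1; rewrite ?invr_gt0.
Qed.

Local Notation G := (local_var j).

Lemma measurable_local_var (u : E -> R) : measurable_fun setT u -> measurable_fun setT (G u).
Proof.
move=> mfu.
have mf : measurable_fun setT (fun z : E * E => ((u z.1 - u z.2) ^+ 2 * j (z.2 - z.1))%:E).
  apply/measurable_EFinP; apply: measurable_funM.
    apply: measurable_funX; apply: measurable_funB.
      exact: (measurableT_comp mfu measurable_fst).
    exact: (measurableT_comp mfu measurable_snd).
  apply: (measurableT_comp mj); apply/measurable_fun_rVP => i.
  under eq_fun do rewrite !mxE.
  apply: measurable_funB.
    exact: (measurableT_comp (measurable_coord i) measurable_snd).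
  exact: (measurableT_comp (measurable_coord i) measurable_fst).
have := @measurable_fun_fubini_tonelli_F _ _ _ _ _ mu _ mf; apply.
by move=> z; rewrite lee_fin mulr_ge0 ?sqr_ge0.
Qed.

(** Two steps suffice to compare any point of the domain with a point of a small
    ball: a jump into that ball, which the lower bound on the reach allows, and a
    short step inside it, which is paid for by the autocorrelation of the kernel. *)
Lemma oscillation_bound (Omega : set E) (a0 : E) (rho0 M : R) :
  measurable Omega -> Omega `<=` [set x | `|x| <= M] -> 0 < rho0 ->
  ball a0 rho0 `<=` Omega ->
  exists rho c K : R, [/\ 0 < rho, 0 < c, 0 <= K, ball a0 rho `<=` Omega &
    forall u : E -> R, measurable_fun setT u -> forall y z, Omega y -> ball a0 rho z ->
    ((c * (u y - u z) ^+ 2)%:E <= 2%:E * G u y +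
       (K%:E * \int[mu]_(x in Omega) G u x + (K%:E * mu (ball a0 rho)) * G u z))%E].
Proof.
move=> mO OM rho0_gt0 BO.
have [r [c [r0 c0 osc]]] := local_oscillation mj j01 j_open.
pose rho := Num.min rho0 (r / 2).
have rho_gt0 : 0 < rho by rewrite lt_min rho0_gt0 divr_gt0.
have [c' c'0 reach] := reach_lower_bound a0 M rho_gt0.
have BO' : ball a0 rho `<=` Omega.
  by apply: subset_trans BO; apply: le_ball; rewrite ge_min lexx.
exists rho, c', (4 / c); split => //; first by rewrite divr_ge0 // ltW.
move=> u mfu y z Oy Bz.
have mB : measurable (ball a0 rho : set E) by exact: measurable_ball_rV.
have mG := measurable_local_var mfu.
have G0 x : (0 <= G u x)%E by exact: local_var_ge0.
have c4 : 0 <= 4 / c by rewrite divr_ge0 // ltW.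
have Bxz a : ball a0 rho a -> `|a - z| < r.
  move=> Ba; have := Ba; have := Bz; rewrite -!ball_normE /ball_ /= => h1 h2.
  rewrite (_ : a - z = (a0 - z) - (a0 - a)); last by apply/rowP => i; rewrite !mxE; ring.
  apply: le_lt_trans (ler_normB _ _) _; rewrite [r]splitr ltrD //.
    by rewrite (lt_le_trans h1) // ge_min lexx orbT.
  by rewrite (lt_le_trans h2) // ge_min lexx orbT.
have mI : measurable_fun setT (fun a : E => ((u y - u a) ^+ 2 * j (a - y))%:E).
  exact: measurable_local_integrand.
have mjy : measurable_fun setT (fun a : E => (j (a - y))%:E) by exact/measurable_EFinP.
have I0 (a : E) : (0 <= ((u y - u a) ^+ 2 * j (a - y))%:E)%E.
  by rewrite lee_fin mulr_ge0 ?sqr_ge0.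
have step : ((c' * (u y - u z) ^+ 2)%:E <= \int[mu]_(a in ball a0 rho)
    (2%:E * ((u y - u a) ^+ 2 * j (a - y))%:E + (4 / c)%:E * (G u a + G u z)))%E.
  rewrite mulrC EFinM.
  apply: (@le_trans _ _ (((u y - u z) ^+ 2)%:E * \int[mu]_(a in ball a0 rho) (j (a - y))%:E)%E).
    by apply: lee_wpmul2l; [rewrite lee_fin sqr_ge0|exact/reach/OM].
  rewrite -ge0_integralZl_EFin ?sqr_ge0 //; last 2 first.
  - by move=> a _; rewrite lee_fin.
  - exact: measurable_funTS.
  apply: ge0_le_integral => //.
  - by move=> a _; rewrite -EFinM lee_fin mulr_ge0 ?sqr_ge0.
  - by apply: measurable_funeM; exact: measurable_funTS.
  - apply: measurable_funTS; apply: emeasurable_funD; apply: measurable_funeM => //.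
    exact: emeasurable_funD.
  move=> a Ba; have h := osc u a z mfu (Bxz _ Ba).
  apply: (@le_trans _ _ ((2 * ((u y - u a) ^+ 2 * j (a - y)))%:E + (2 * (u a - u z) ^+ 2)%:E)%E).
    rewrite -EFinM -EFinD lee_fin.
    apply: (@le_trans _ _ ((2 * (u y - u a) ^+ 2 + 2 * (u a - u z) ^+ 2) * j (a - y))).
      by apply: ler_wpM2r => //; exact: sqr_subr_le2.
    by rewrite mulrDl -mulrA lerD2l ler_piMr // mulr_ge0 ?sqr_ge0.
  rewrite EFinM leeD2l //.
  have -> : ((2 * (u a - u z) ^+ 2)%:E = (2 / c)%:E * (c * (u a - u z) ^+ 2)%:E)%E.
    by rewrite -EFinM; congr EFin; field; rewrite gt_eqF.
  apply: le_trans (lee_wpmul2l _ h) _; first by rewrite lee_fin divr_ge0 // ltW.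
  rewrite muleA -EFinM (_ : 2 / c * 2 = 4 / c) //.
  by rewrite mulrAC -natrM.
apply: le_trans step _.
rewrite ge0_integralD //; last 4 first.
- by move=> a _; rewrite mule_ge0.
- by apply: measurable_funeM; exact: measurable_funTS.
- by move=> a _; rewrite mule_ge0 // adde_ge0.
- apply: measurable_funTS; apply: measurable_funeM; exact: emeasurable_funD.
rewrite !ge0_integralZl_EFin //; last 3 first.
- by move=> a _; rewrite adde_ge0.
- by apply: measurable_funTS; exact: emeasurable_funD.
- exact: measurable_funTS.
apply: leeD.
  by apply: lee_wpmul2l => //; apply: ge0_subset_integral.
rewrite ge0_integralD //; try exact: measurable_funTS.
have SB0 : (0 <= \int[mu]_(x in ball a0 rho) G u x)%E by exact: integral_ge0.
have GB0 : (0 <= G u z * mu (ball a0 rho))%E by exact: mule_ge0.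
rewrite integral_cst_rV // ge0_muleDr //.
apply: leeD.
  apply: lee_wpmul2l; first by rewrite lee_fin.
  by apply: ge0_subset_integral => //; exact: measurable_funTS.
by rewrite -muleA [(G u z * _)%E]muleC.
Qed.

(** Integrate the oscillation bound over [y] in the domain, where the subtraction of
    the constant [u z] can only increase the square norm of a mean-zero function, and
    then over [z] in the small ball, which turns [G u z] into a part of the energy. *)
Theorem nonlocal_poincare (Omega : set E) (a0 : E) (rho0 M : R) :
  measurable Omega -> Omega `<=` [set x | `|x| <= M] -> 0 < rho0 ->
  ball a0 rho0 `<=` Omega ->
  exists2 C : R, 0 < C & forall u : E -> R, measurable_fun setT u ->
    (\int[mu]_(x in Omega) (u x ^+ 2)%:E < +oo)%E ->
    \int[mu]_(x in Omega) u x = 0 ->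
    (\int[mu]_(x in Omega) (u x ^+ 2)%:E <= C%:E * \int[mu]_(x in Omega) G u x)%E.
Proof.
move=> mO OM rho0_gt0 BO.
have [rho [c [K [rho_gt0 c0 K0 BO' osc]]]] := oscillation_bound mO OM rho0_gt0 BO.
pose B := ball a0 rho; have mB : measurable B by exact: measurable_ball_rV.
have Ooo : (mu Omega < +oo)%E.
  apply: le_lt_trans (lebesgue_rV_bounded n M); apply: le_measure; rewrite ?inE //.
  exact: measurable_norm_le_rV.
have Boo : (mu B < +oo)%E.
  by apply: le_lt_trans Ooo; apply: le_measure; rewrite ?inE.
have B0 : (0 < mu B)%E.
  rewrite lt0e measure_ge0 andbT; apply/eqP => B0.
  have : (0 < \int[mu]_(h in B) (j h)%:E)%E.
    by apply: j_open; [exact: ball_open|exists a0; exact: ballxx].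
  by rewrite null_set_integral ?ltxx //; apply: measurable_funTS; exact/measurable_EFinP.
have [m mE] : exists m, mu Omega = m%:E by exists (fine (mu Omega)); rewrite fineK // ge0_fin_numE.
have [b bE] : exists b, mu B = b%:E by exists (fine (mu B)); rewrite fineK // ge0_fin_numE.
have m0 : 0 <= m by rewrite -lee_fin -mE.
have b0 : 0 < b by rewrite -lte_fin -bE.
have C0 : 0 < (2 + 2 * (m * K)) / c by rewrite divr_gt0 // ltr_wpDr // !mulr_ge0.
exists ((2 + 2 * (m * K)) / c) => //.
move=> u mfu u2 u0.
have mG := measurable_local_var mfu.
have G0 x : (0 <= G u x)%E by exact: local_var_ge0.
set L := (\int[mu]_(x in Omega) _)%E; set S := (\int[mu]_(x in Omega) _)%E.
have S0 : (0 <= S)%E by exact: integral_ge0.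
have [Soo|Soo] := eqVneq S +oo%E.
  by rewrite Soo gt0_muley ?leey // lte_fin.
have [s sE] : exists s, S = s%:E.
  by exists (fine S); rewrite fineK // ge0_fin_numE // ltey.
have s0 : 0 <= s by rewrite -lee_fin -sE.
have [l lE] : exists l, L = l%:E.
  exists (fine L); rewrite fineK // ge0_fin_numE // integral_ge0 // => x _.
  by rewrite lee_fin sqr_ge0.
have msq (z : E) : measurable_fun setT (fun y : E => ((u y - u z) ^+ 2)%:E).
  by apply: measurable_sqr; apply: measurable_funB.
have c0' : 0 <= c by exact: ltW.
have b0' : 0 <= b by exact: ltW.
have Bz z : B z -> ((c * l)%:E <= (2 * s + m * (K * s))%:E + (m * (K * b))%:E * G u z)%E.
  move=> Bz; rewrite EFinM -lE.
  apply: (@le_trans _ _ (\int[mu]_(y in Omega) (c%:E * ((u y - u z) ^+ 2)%:E))%E).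
    rewrite ge0_integralZl_EFin //; last 2 first.
    - by move=> y _; rewrite lee_fin sqr_ge0.
    - exact: measurable_funTS.
    apply: lee_wpmul2l; first by rewrite lee_fin ltW.
    by apply: sqnorm_le_sub_cst => //; exact: measurable_funTS.
  apply: (@le_trans _ _ (\int[mu]_(y in Omega) (2%:E * G u y +
       (K%:E * S + (K%:E * mu B) * G u z)))%E).
    apply: ge0_le_integral => //.
    - by move=> y _; rewrite -EFinM lee_fin mulr_ge0 ?sqr_ge0 // ltW.
    - by apply: measurable_funTS; exact: measurable_funeM.
    - apply: measurable_funTS; apply: emeasurable_funD => //.
      exact: measurable_funeM.
    - by move=> y Oy; rewrite -EFinM; exact: osc.
  have t0 : (0 <= K%:E * S + (K%:E * mu B) * G u z)%E.
    by rewrite adde_ge0 // ?mule_ge0.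
  rewrite ge0_integralD //; last 2 first.
  - by move=> y _; rewrite mule_ge0.
  - by apply: measurable_funTS; exact: measurable_funeM.
  rewrite ge0_integralZl_EFin //; last exact: measurable_funTS.
  rewrite -/S integral_cst_rV // sE mE bE -EFinM.
  rewrite [((K%:E * _ + _) * _)%E]muleC ge0_muleDr ?mule_ge0 ?lee_fin //.
  by rewrite addeA !muleA -!EFinM -EFinD !mulrA.
have : (\int[mu]_(z in B) (cst (c * l)%:E z) <=
    \int[mu]_(z in B) ((2 * s + m * (K * s))%:E + (m * (K * b))%:E * G u z))%E.
  have l0 : 0 <= l.
    by rewrite -lee_fin -lE integral_ge0 // => x _; rewrite lee_fin sqr_ge0.
  apply: ge0_le_integral => //.
  - by move=> z _; rewrite lee_fin mulr_ge0 // ltW.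
  - apply: measurable_funTS; apply: emeasurable_funD => //; exact: measurable_funeM.
have k1 : 0 <= 2 * s + m * (K * s) by rewrite addr_ge0 ?mulr_ge0.
have k2 : 0 <= m * (K * b) by rewrite !mulr_ge0 // ltW.
rewrite integral_cst_rV // ge0_integralD //; last 2 first.
- by move=> z _; rewrite mule_ge0.
- by apply: measurable_funTS; exact: measurable_funeM.
rewrite integral_cst_rV // ge0_integralZl_EFin //; last exact: measurable_funTS.
have BS : (\int[mu]_(z in B) G u z <= s%:E)%E.
  by rewrite -sE; apply: ge0_subset_integral => //; exact: measurable_funTS.
move=> /le_trans /(_ (leeD2l _ (lee_wpmul2l _ BS))) => H'; have {H'} := H' k2.
rewrite bE -!EFinM -EFinD lee_fin => H.
rewrite lE sE -EFinM lee_fin mulrAC ler_pdivlMr // -(ler_pM2r b0) mulrC.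
rewrite (_ : b * (l * c) = c * l * b); last by ring.
by rewrite (_ : _ * s * b = (2 * s + m * (K * s)) * b + m * (K * b) * s) //; ring.
Qed.

End poincare_inequality.

(** * Riesz representation by minimisation *)

Section riesz.
Context (R : realType) (V : lmodType R).
Variables (X : V -> Prop) (a : V -> V -> R) (F : V -> R) (M : R).
Hypothesis X0 : X 0.
Hypothesis XD : forall s t v w, X v -> X w -> X (s *: v + t *: w).
Hypothesis aC : forall v w, X v -> X w -> a v w = a w v.
Hypothesis aD : forall s t v w z, X v -> X w -> X z ->
  a (s *: v + t *: w) z = s * a v z + t * a w z.
Hypothesis a_ge0 : forall v, X v -> 0 <= a v v.
Hypothesis FD : forall s t v w, X v -> X w -> F (s *: v + t *: w) = s * F v + t * F w.
Hypothesis M0 : 0 <= M.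
Hypothesis Fbounded : forall v, X v -> F v ^+ 2 <= M * a v v.
Hypothesis Xcomplete : forall u : nat -> V, (forall k, X (u k)) ->
  (forall e, 0 < e -> exists N, forall p q, (N <= p)%N -> (N <= q)%N ->
     a (u p - u q) (u p - u q) <= e) ->
  exists2 w, X w & forall e, 0 < e -> exists N, forall p, (N <= p)%N ->
     a (u p - w) (u p - w) <= e.

Let J v := a v v - 2 * F v.

Let a_comb s t v w : X v -> X w ->
  a (s *: v + t *: w) (s *: v + t *: w) =
    s ^+ 2 * a v v + 2 * s * t * a v w + t ^+ 2 * a w w.
Proof.
move=> Xv Xw; have Xs := XD s t Xv Xw.
rewrite aD // (aC Xv Xs) (aC Xw Xs) !aD // (aC Xw Xv); ring.
Qed.

Let subE (v w : V) : v - w = 1 *: v + (-1) *: w.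
Proof. by rewrite scale1r scaleN1r. Qed.

Let XB v w : X v -> X w -> X (v - w).
Proof. by rewrite subE; exact: XD. Qed.

Let a_cs v w : X v -> X w -> a v w ^+ 2 <= a v v * a w w.
Proof.
move=> Xv Xw; apply: discriminant_le => s t; rewrite -a_comb //.
exact/a_ge0/XD.
Qed.

Let J_lb v : X v -> - M <= J v.
Proof.
move=> Xv; have := Fbounded Xv; have := a_ge0 Xv; rewrite /J => h1 h2.
suff : 2 * F v <= a v v + M by lra.
apply: le_trans (ler_norm _) _; rewrite -ler_sqr ?nnegrE ?addr_ge0 //.
rewrite real_normK ?num_real // exprMn.
have := sqr_ge0 (a v v - M); nra.
Qed.

(** The quadratic functional [a v v - 2 F v] is bounded below by continuity of F; by
    the parallelogram law its minimising sequences are Cauchy, and the limit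
    solves the Euler equation. The form [a] may be degenerate: limits are only meant in
    its seminorm. *)
Lemma riesz_representation : exists2 u, X u & forall v, X v -> a u v = F v.
Proof.
pose S : set R := [set J v | v in [set v | X v]].
have SI : has_inf S.
  split; first by exists (J 0), 0.
  by exists (- M) => _ [v Xv <-]; exact: J_lb.
pose i := inf S.
have iJ v : X v -> i <= J v by move=> Xv; apply: ge_inf; [exact: SI.2|exists v].
have /choice[u uP] (k : nat) : exists v, X v /\ J v <= i + k.+1%:R^-1.
  have [|_ [v Xv <-] /ltW ?] := @inf_adherent R S k.+1%:R^-1 _ SI.
    by rewrite invr_gt0.
  by exists v.
(* parallelogram law, applied at the midpoint *)
have par v w : X v -> X w -> a (v - w) (v - w) <= 2 * (J v - i) + 2 * (J w - i).
  move=> Xv Xw; have Xh := XD 2^-1 2^-1 Xv Xw; have := iJ _ Xh.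
  rewrite /J FD // a_comb // subE a_comb //; lra.
have small (e : R) : 0 < e -> exists N, forall p, (N <= p)%N -> p.+1%:R^-1 <= e.
  move=> e0; exists (Num.truncn e^-1) => p Np.
  rewrite invf_ple ?posrE //; apply: le_trans (ltW (truncnS_gt _)) _.
  by rewrite ler_nat.
have Xu k : X (u k) by have [] := uP k.
have [e e0|w Xw cvw] := Xcomplete Xu.
  have e4 : 0 < e / 4 by rewrite divr_gt0.
  have [N HN] := small _ e4; exists N => p q Np Nq.
  have [_ h1] := uP p; have [_ h2] := uP q.
  have {}h1 := le_trans h1 (lerD (lexx i) (HN p Np)).
  have {}h2 := le_trans h2 (lerD (lexx i) (HN q Nq)).
  have := par _ _ (Xu p) (Xu q); lra.
exists w => // v Xv.
(* the almost minimality of [u k] against [u k + (t / s) *: v], in homogeneous form *)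
have key k : (a (u k) v - F v) ^+ 2 <= k.+1%:R^-1 * a v v.
  apply: discriminant_le => s t.
  have [->|s0] := eqVneq s 0.
    by rewrite expr0n !mul0r !(mulr0, mul0r) !add0r mulr_ge0 ?sqr_ge0 ?a_ge0.
  have := iJ _ (XD 1 (t / s) (Xu k) Xv); have [_ h] := uP k.
  rewrite /J FD // a_comb // => h2; rewrite /J in h.
  have {h h2}h3 : 0 <= k.+1%:R^-1 + 2 * (t / s) * (a (u k) v - F v) + (t / s) ^+ 2 * a v v.
    by move: (k.+1%:R^-1) (t / s) h h2 => y x h h2; lra.
  have := mulr_ge0 (sqr_ge0 s) h3; congr (_ <= _); field.
  by rewrite s0 andbT nat1r pnatr_eq0.
have key2 e : 0 < e -> (a w v - F v) ^+ 2 <= e * a v v.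
  move=> e0; have e4 : 0 < e / 4 by rewrite divr_gt0.
  have [N1 H1] := small _ e4; have [N2 H2] := cvw _ e4.
  pose p := maxn N1 N2.
  have h1 := H1 p (leq_maxl _ _); have h2 := H2 p (leq_maxr _ _).
  have h3 := key p; have h4 := a_cs (XB (Xu p) Xw) Xv.
  have h5 : a (u p - w) v = a (u p) v - a w v by rewrite subE aD //; ring.
  have av := a_ge0 Xv.
  have k1 : p.+1%:R^-1 * a v v <= e / 4 * a v v by rewrite ler_wpM2r.
  have k2 : a (u p - w) (u p - w) * a v v <= e / 4 * a v v by rewrite ler_wpM2r.
  rewrite h5 in h4.
  have {h3 k1}h3 := le_trans h3 k1; have {h4 k2}h4 := le_trans h4 k2.
  have := sqr_ge0 ((a (u p) v - F v) + (a (u p) v - a w v)); lra.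
apply/eqP; rewrite -subr_eq0 -sqrf_eq0 eq_le sqr_ge0 andbT; apply/ler_addgt0Pl => e e0.
rewrite addr0.
have av1 : 0 < a v v + 1 by rewrite ltr_wpDl // a_ge0.
apply: le_trans (key2 (e / (a v v + 1)) _) _; first by rewrite divr_gt0.
rewrite mulrAC ler_pdivrMr // ler_pM2l // lerDl //.
Qed.

End riesz.

(** * Almost everywhere convergent subsequences *)

Section sequences_of_functions.
Context d (T : measurableType d) (R : realType) (m : {measure set T -> \bar R}).

Lemma fatou_le (D : set T) (f : nat -> T -> \bar R) (g : T -> \bar R) (e : \bar R) (N : nat) :
  measurable D -> (forall k, measurable_fun D (f k)) ->
  (forall k x, D x -> (0 <= f k x)%E) ->
  (forall x, D x -> f ^~ x @ \oo --> g x) ->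
  (forall k, (N <= k)%N -> (\int[m]_(x in D) f k x <= e)%E) ->
  (\int[m]_(x in D) g x <= e)%E.
Proof.
move=> mD mf f0 fg fe.
have gE x : D x -> g x = limn_einf (f ^~ x).
  move=> Dx; rewrite is_cvg_limn_einfE; last by apply/cvg_ex; exists (g x); exact: fg.
  by apply/esym/cvg_lim => //; exact: fg.
rewrite (eq_integral (fun x => limn_einf (f ^~ x))); last by move=> x /[!inE]; exact: gE.
apply: le_trans (fatou m mD mf f0) _.
rewrite limn_einf_lim; apply: lime_le; first exact: is_cvg_einfs.
near=> k; apply: (@le_trans _ _ (\int[m]_(x in D) f (maxn k N) x)%E).
  by apply: ereal_inf_lbound; exists (maxn k N) => //=; exact: leq_maxl.
by apply: fe; exact: leq_maxr.
Unshelve. all: by end_near. Qed.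

Lemma cvgn_of_geometric_steps (v : nat -> R) (K : R) : 0 <= K ->
  (forall k, (v k.+1 - v k) ^+ 2 <= K / 4 ^+ k) -> cvgn v.
Proof.
move=> K0 vK.
have -> : v = cst (v 0%N) + series (telescope v).
  by apply/funext => k; rewrite [LHS]eq_sum_telescope.
apply: is_cvgD; first exact: is_cvg_cst.
apply: normed_cvg.
apply: (@series_le_cvg _ _ (geometric (Num.sqrt K) 2^-1)) => [k|k|k|].
- exact: normr_ge0.
- by rewrite /geometric /= mulr_ge0 ?sqrtr_ge0 // exprn_ge0.
- rewrite /geometric /= -ler_sqr ?nnegrE ?mulr_ge0 ?sqrtr_ge0 ?exprn_ge0 //.
  rewrite real_normK ?num_real // exprMn sqr_sqrtr // -exprM mulnC exprM.
  apply: le_trans (vK k) _; rewrite -exprVn ler_wpM2l // lerXn2r ?nnegrE //.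
  by rewrite exprVn (_ : 2 ^+ 2 = 4 :> R) // expr2 -natrM.
- by apply: is_cvg_geometric_series; rewrite ger0_norm // invf_lt1 // ltr1n.
Qed.

(** The pointwise half of the Riesz-Fischer theorem. Along a fast subsequence the
    weighted squares of the steps have a finite sum almost everywhere, even when
    multiplied by [4 ^+ k]; as the weight vanishes nowhere, the steps then decay
    geometrically. *)
Lemma ae_convergent_subsequence (rho : T -> R) (u : nat -> T -> R) :
  measurable_fun setT rho -> (forall x, 0 < rho x) ->
  (forall k, measurable_fun setT (u k)) ->
  (forall e : R, 0 < e -> exists N, forall p q, (N <= p)%N -> (N <= q)%N ->
     (\int[m]_x ((u p x - u q x) ^+ 2 * rho x)%:E <= e%:E)%E) ->
  exists (phi : nat -> nat) (N : set T) (w : T -> R),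
    [/\ forall k, (k <= phi k)%N, measurable N, m N = 0%E, measurable_fun setT w &
        forall x, (fun k => (u (phi k) \_ (~` N)) x) @ \oo --> w x].
Proof.
move=> mrho rho0 mfu cau.
(* after multiplication by [4 ^+ k] these tolerances still sum up to 1 *)
pose eps k : R := (4 ^+ k)^-1 * (1 / (2 ^ k.+1)%:R).
have eps0 k : 0 < eps k by rewrite mulr_gt0 ?invr_gt0 ?exprn_gt0 // divr_gt0 // ltr0n expn_gt0.
have /choice[A HA] k := cau _ (eps0 k).
pose phi k := (\sum_(i < k.+1) (A i).+1)%N.
have phiS k : phi k.+1 = (phi k + (A k.+1).+1)%N by rewrite /phi big_ord_recr.
have phiA k : (A k <= phi k)%N by rewrite /phi big_ord_recr /= addnS -addSn leq_addl.
have phik k : (k <= phi k)%N.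
  elim: k => // k IHk; rewrite phiS addnS ltnS; exact: leq_trans IHk (leq_addr _ _).
pose f k x := (4 ^+ k * ((u (phi k.+1) x - u (phi k) x) ^+ 2 * rho x))%:E.
have f0 k x : (0 <= f k x)%E.
  by rewrite lee_fin mulr_ge0 ?exprn_ge0 // mulr_ge0 ?sqr_ge0 // ltW.
have mg k : measurable_fun setT (fun x => ((u (phi k.+1) x - u (phi k) x) ^+ 2 * rho x)%:E).
  apply/measurable_EFinP; apply: measurable_funM => //.
  by apply: measurable_funX; exact: measurable_funB.
have mf k : measurable_fun setT (f k).
  by apply/measurable_EFinP; apply: measurable_funM => //; apply/measurable_EFinP; exact: mg.
pose H x := (\sum_(k <oo) f k x)%E.
have H0 x : (0 <= H x)%E by apply: nneseries_ge0.
have mH : measurable_fun setT H by exact: ge0_emeasurable_sum.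
have iH : (\int[m]_x H x <= 1)%E.
  rewrite integral_nneseries //.
  apply: (@le_trans _ _ (\sum_(k <oo) (1 / (2 ^ k.+1)%:R)%:E)%E); last exact: epsilon_trick0.
  apply: lee_nneseries => [k _ _|k _].
    by apply: integral_ge0 => x _.
  have -> : (\int[m]_x f k x = (4 ^+ k)%:E *
      \int[m]_x ((u (phi k.+1) x - u (phi k) x) ^+ 2 * rho x)%:E)%E.
    rewrite -ge0_integralZl_EFin ?exprn_ge0 //.
    by move=> x _; rewrite lee_fin mulr_ge0 ?sqr_ge0 // ltW.
  have le1 : (A k <= phi k.+1)%N by rewrite phiS (leq_trans (phiA k)) // leq_addr.
  have := HA k _ _ le1 (phiA k).
  have p4 : (0 <= (4 ^+ k : R)%:E)%E by rewrite lee_fin exprn_ge0.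
  move=> /(lee_wpmul2l p4) /le_trans; apply.
  by rewrite -EFinM lee_fin /eps mulVKf // gt_eqF // exprn_gt0.
have [N [mN N0 HN]] : {ae m, forall x, setT x -> H x \is a fin_num}.
  apply: (@integrable_ae _ _ _ m setT measurableT H).
  apply/integrableP; split => //.
  under eq_integral do rewrite gee0_abs //.
  by apply: le_lt_trans iH _; rewrite ltry.
have cv x : ~ N x -> cvgn (fun k => u (phi k) x).
  move=> Nx; have Hx : H x \is a fin_num by apply: contrapT => h; apply: Nx; apply: HN => /(_ I).
  pose h := fine (H x).
  have h0 : 0 <= h by rewrite fine_ge0.
  apply: (@cvgn_of_geometric_steps _ (h / rho x)); first by rewrite divr_ge0 // ltW.
  move=> k; have : (f k x <= h%:E)%E.
    rewrite fineK //; apply: le_trans (nneseries_lim_ge k.+1 _) => //.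
    by rewrite big_nat_recr //= leeDr // sume_ge0.
  rewrite lee_fin mulrA -ler_pdivlMr // => h1.
  by rewrite ler_pdivlMr ?exprn_gt0 // mulrC.
pose w x := limn (fun k => (u (phi k) \_ (~` N)) x).
have cw x : (fun k => (u (phi k) \_ (~` N)) x) @ \oo --> w x.
  have : cvgn (fun k => (u (phi k) \_ (~` N)) x).
    have [Nx|Nx] := pselect (N x).
      rewrite (_ : (fun k => _) = cst 0); first exact: is_cvg_cst.
      by apply/funext => k; rewrite /patch memNset.
    rewrite (_ : (fun k => _) = (fun k => u (phi k) x)); first exact: cv.
    by apply/funext => k; rewrite /patch mem_set.
  by [].
exists phi, N, w; split => //.
apply: (measurable_fun_cvg (h := fun k => u (phi k) \_ (~` N))) => [k|x _]; last exact: cw.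
by apply/(measurable_restrictT _ _).1; [exact: measurableC|exact: measurable_funTS].
Qed.

End sequences_of_functions.

(** * The Levy density *)

(* simplification would otherwise unfold the measure in dimension [n.+1] *)
Arguments lebesgue_rV {R n} _ : simpl never.

Section levy_density_facts.
Context {R : realType} (n : nat).
Local Notation E := 'rV[R]_n.+1.
Local Notation mu := (@lebesgue_rV R n.+1).
Variable nu : E -> R.
Hypothesis levy_nu : levy_density nu.
Hypothesis full_nu : full_support nu.

(** The value of [nu] at the origin is arbitrary; replacing it by 0 makes the density
    nonnegative and measurable on the whole space. *)
Definition offdiag_density (h : E) : R := if h == 0 then 0 else nu h.

(** The bounded and integrable kernel to which the Poincare inequality is applied; it
    is also the kernel of the weight [nu_tilde]. *)
Definition trunc_density (h : E) : R := Num.min 1 (offdiag_density h).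

Local Notation nu0 := offdiag_density.
Local Notation j := trunc_density.

Lemma measurable_set1_rV (a : E) : measurable [set a].
Proof.
rewrite (_ : [set a] =
    [set x : E | forall i, ([set a ord0 i] : set (measurableTypeR R)) (x ord0 i)]).
  by apply: (@measurable_box _ _ (fun i => [set a ord0 i])) => i; exact: measurable_set1.
by apply/seteqP; split=> [x /= -> //|x /= xA]; apply/rowP => i; exact: xA.
Qed.

Lemma offdiag_density_patch : nu0 = nu \_ [set~ 0].
Proof.
apply/funext => h; rewrite /nu0 /patch; case: eqP => [->|h0].
  by rewrite memNset //= => /(_ erefl).
by rewrite mem_set.
Qed.

Lemma measurable_offdiag_density : measurable_fun setT nu0.
Proof.
have [mnu _ _ _] := levy_nu; rewrite offdiag_density_patch.
by apply/(measurable_restrictT _ _).1 => //; apply: measurableC; exact: measurable_set1_rV.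
Qed.

Lemma offdiag_density_ge0 h : 0 <= nu0 h.
Proof. by rewrite /nu0; case: eqP => // /eqP h0; have [_ + _ _] := levy_nu; apply. Qed.

Lemma offdiag_densityN h : nu0 (- h) = nu0 h.
Proof.
rewrite /nu0 oppr_eq0; case: eqP => // /eqP h0; have [_ _ + _] := levy_nu.
by move=> H; exact/esym/H.
Qed.

Lemma measurable_density : measurable_fun setT nu.
Proof.
rewrite (_ : nu = (fun h => nu0 h + nu 0 * \1_[set 0] h)).
  apply: measurable_funD; first exact: measurable_offdiag_density.
  by apply: measurable_funM => //; apply: measurable_indic; exact: measurable_set1_rV.
apply/funext => h; rewrite /nu0 indicE; case: eqP => [->|h0].
  by rewrite mem_set // mulr1 add0r.
by rewrite memNset //= mulr0 addr0.
Qed.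

Lemma measurable_trunc_density : measurable_fun setT j.
Proof. by apply: measurable_minr => //; exact: measurable_offdiag_density. Qed.

Lemma trunc_density01 h : 0 <= j h <= 1.
Proof. by rewrite /j le_min ler01 offdiag_density_ge0 /= ge_min lexx. Qed.

Lemma trunc_densityN h : j (- h) = j h.
Proof. by rewrite /j offdiag_densityN. Qed.

Lemma trunc_density_le h : j h <= nu0 h.
Proof. by rewrite /j ge_min lexx orbT. Qed.

Lemma enorm_sqr (x : E) : enorm x ^+ 2 = \sum_i x ord0 i ^+ 2.
Proof. by rewrite sqr_sqrtr // sumr_ge0 // => i _; exact: sqr_ge0. Qed.

Lemma norm_le_enorm (x : E) : `|x| ^+ 2 <= enorm x ^+ 2.
Proof.
rewrite enorm_sqr.
have [->|x0] := eqVneq x 0.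
  by rewrite normr0 expr0n sumr_ge0 // => i _; exact: sqr_ge0.
have [[i k] xE] : exists ij : 'I_1 * 'I_n.+1, `|x| = `|x ij.1 ij.2|.
  by apply: mx_norm_neq0; apply: contra_neq x0; exact: mx_norm_eq0.
rewrite xE /= (ord1 i) real_normK ?num_real // (bigD1 k) //= lerDl.
by rewrite sumr_ge0 // => l _; exact: sqr_ge0.
Qed.

(** It is at most 1 on the unit ball and at most the Levy integrand elsewhere. *)
Lemma integral_trunc_density : (\int[mu]_h (j h)%:E < +oo)%E.
Proof.
have [mnu nu_ge0 _ levy] := levy_nu.
pose D : set E := [set x | `|x| <= 1].
have mD : measurable D by exact: measurable_norm_le_rV.
pose f := ((fun h => (Num.min 1 (enorm h ^+ 2) * nu h)%:E) \_ [set~ (0 : E)]).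
have m0 : measurable [set~ (0 : E)] by apply: measurableC; exact: measurable_set1_rV.
have mf : measurable_fun setT f.
  apply: (measurable_restrictT _ m0).1; apply/measurable_EFinP; apply: measurable_funM => //.
  apply: measurable_minr => //; apply: measurable_funTS.
  under eq_fun do rewrite enorm_sqr.
  apply: measurable_sum => i; apply: measurable_funX; exact: measurable_coord.
have f0 h : (0 <= f h)%E.
  apply: erestrict_ge0 => {}h /= /eqP h0; rewrite lee_fin mulr_ge0 ?nu_ge0 //.
  by rewrite le_min ler01 sqr_ge0.
have fi : (\int[mu]_h f h < +oo)%E by rewrite -integral_mkcond.
have mI : measurable_fun setT (fun h : E => (\1_D h)%:E : \bar R).
  by apply/measurable_EFinP; exact: measurable_indic.
apply: (@le_lt_trans _ _ (\int[mu]_h ((\1_D h)%:E + f h))%E).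
  apply: ge0_le_integral => //.
  - by move=> h _; rewrite lee_fin; have /andP[] := trunc_density01 h.
  - by apply/measurable_EFinP; exact: measurable_trunc_density.
  - exact: emeasurable_funD.
  - move=> h _; rewrite indicE; have [hD|hD] := pselect (D h).
      rewrite mem_set //; apply: (@le_trans _ _ 1%E); last by rewrite leeDl.
      by rewrite lee_fin; have /andP[] := trunc_density01 h.
    rewrite memNset // add0e /f /patch; have h1 : 1 < `|h| by rewrite ltNge; exact/negP.
    have h0 : h != 0 by rewrite -normr_gt0 (lt_trans _ h1).
    rewrite mem_set /=; last exact/eqP.
    rewrite lee_fin min_l ?mul1r; last first.
      by apply: le_trans (norm_le_enorm h); rewrite -(expr1n _ 2) ler_sqr ?nnegrE // ltW.
    by apply: le_trans (trunc_density_le h) _; rewrite /nu0 (negbTE h0).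
rewrite ge0_integralD //.
apply: lte_add_pinfty => //.
rewrite integral_indic // setIT; exact: lebesgue_rV_bounded.
Qed.

(** If the truncated density vanished almost everywhere on [U], so would [nu]. *)
Lemma integral_trunc_density_open (U : set E) : open U -> U !=set0 ->
  (0 < \int[mu]_(h in U) (j h)%:E)%E.
Proof.
move=> oU [x Ux].
have mU := open_measurable_rV oU.
have mj : measurable_fun U (fun h => (j h)%:E).
  by apply: measurable_funTS; apply/measurable_EFinP; exact: measurable_trunc_density.
have j0 h : (0 <= (j h)%:E)%E by rewrite lee_fin; have /andP[] := trunc_density01 h.
rewrite lt0e integral_ge0 // andbT; apply/eqP => jU0.
have /(ae_eq_integral_abs mu mU mj) [N [mN N0 HN]] :
    (\int[mu]_(h in U) `|(j h)%:E| = 0)%E.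
  by under eq_integral do rewrite gee0_abs //.
have : density_support nu x by rewrite full_nu.
move=> /(_ U oU Ux); rewrite lt0e => /andP[/eqP + _]; apply.
have mU0 : measurable (U `\ (0 : E)) by apply: measurableD => //; exact: measurable_set1_rV.
rewrite (ge0_negligible_integral mN) //; last 2 first.
- by apply/measurable_EFinP; apply: measurable_funTS; exact: measurable_density.
- move=> h [_ /= /eqP h0]; rewrite lee_fin; have [_ + _ _] := levy_nu; exact.
rewrite integral0_eq // => h [[Uh /= /eqP h0] nN].
have : j h = 0.
  apply: contrapT => jh; apply: nN; apply: HN => /= H; apply: jh; exact: (EFin_inj (H Uh)).
rewrite /j /nu0 (negbTE h0) /Num.min; case: ifP => _ H; last by rewrite H.
by move: (@oner_neq0 R); rewrite H eqxx.
Qed.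

End levy_density_facts.

(** * The exterior weight *)

Section nonlocal_weight.
Context {R : realType} (n : nat).
Local Notation E := 'rV[R]_n.+1.
Local Notation mu := (@lebesgue_rV R n.+1).
Variables (nu : E -> R) (B : set E) (M : R).
Hypothesis levy_nu : levy_density nu.
Hypothesis full_nu : full_support nu.
Hypothesis openB : open B.
Hypothesis B0 : B !=set0.
Hypothesis BM : B `<=` [set x | `|x| <= M].
Local Notation j := (trunc_density nu).

Let mB : measurable B. Proof. exact: open_measurable_rV. Qed.

Let mj := measurable_trunc_density levy_nu.

Lemma trunc_density_ge0 h : 0 <= j h.
Proof. by have /andP[] := trunc_density01 levy_nu h. Qed.

Lemma measurable_sub_rV : measurable_fun setT (fun z : E * E => z.1 - z.2).
Proof.
apply/measurable_fun_rVP => i; under eq_fun do rewrite !mxE.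
apply: measurable_funB.
  exact: (measurableT_comp (measurable_coord i) measurable_fst).
exact: (measurableT_comp (measurable_coord i) measurable_snd).
Qed.

Lemma bounded_finite_measure : (mu B < +oo)%E.
Proof.
apply: le_lt_trans (lebesgue_rV_bounded _ M).
by apply: le_measure; rewrite ?inE //; exact: measurable_norm_le_rV.
Qed.

Lemma nu_tildeE x : (nu_tilde nu B x)%:E = (\int[mu]_(y in B) (j (x - y))%:E)%E.
Proof.
have msub : measurable_fun setT (fun y : E => x - y).
  apply/measurable_fun_rVP => i; under eq_fun do rewrite !mxE.
  by apply: measurable_funB => //; exact: measurable_coord.
have mjx : measurable_fun B (fun y => (j (x - y))%:E).
  by apply: measurable_funTS; apply/measurable_EFinP; exact: (measurableT_comp mj msub).
rewrite /nu_tilde /Rintegral.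
have -> : (\int[mu]_(y in B) (Num.min 1 (nu (x - y)))%:E = \int[mu]_(y in B) (j (x - y))%:E)%E.
  (* only at [y = x], where [nu] is evaluated at the origin, may the integrands differ *)
  apply: ae_eq_integral => //.
    apply: measurable_funTS; apply/measurable_EFinP; apply: measurable_minr => //.
    exact: (measurableT_comp (measurable_density levy_nu) msub).
  exists [set x]; split; [exact: measurable_set1_rV|exact: lebesgue_rV_set1|].
  move=> y /= H; apply: contrapT => yx; apply: H => _.
  by rewrite /trunc_density /offdiag_density subr_eq0 eq_sym; case: eqP => // /yx.
rewrite fineK // ge0_fin_numE; last first.
  by apply: integral_ge0 => y _; rewrite lee_fin trunc_density_ge0.
apply: (@le_lt_trans _ _ (\int[mu]_(y in B) (cst 1%E y))%E).
  apply: ge0_le_integral => //.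
  - by move=> y _; rewrite lee_fin trunc_density_ge0.
  - by move=> y _; rewrite lee_fin; have /andP[] := trunc_density01 levy_nu (x - y).
by rewrite integral_cst // mul1e; exact: bounded_finite_measure.
Qed.

Lemma nu_tilde_gt0 x : 0 < nu_tilde nu B x.
Proof.
rewrite -lte_fin nu_tildeE.
pose U := (fun w => w + x) @^-1` B.
have cx : continuous (fun w : E => w + x).
  by move=> w; apply: (@continuousD _ _ _ id (cst x) w); [exact: cvg_id|exact: cst_continuous].
have oU : open U by apply: open_comp => // w _; exact: cx.
have U0 : U !=set0 by have [b Bb] := B0; exists (b - x); rewrite /U /= subrK.
have := integral_trunc_density_open levy_nu full_nu oU U0.
rewrite [X in (0 < X -> _)%E]integral_mkcond [X in (_ -> 0 < X)%E]integral_mkcond.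
congr (0 < _)%E.
rewrite -[LHS](@ge0_integral_translate _ _ (- x)).
- apply: eq_integral => y _; rewrite /patch /U.
  have -> : (y - x \in (fun w => w + x) @^-1` B) = (y \in B).
    by apply/idP/idP; rewrite !inE /= subrK.
  by case: ifP => // _; rewrite -trunc_densityN // opprB.
- apply/(measurable_restrictT _ _).1; first exact: open_measurable_rV.
  by apply: measurable_funTS; exact/measurable_EFinP.
- by move=> w; apply: erestrict_ge0 => ? _; rewrite lee_fin trunc_density_ge0.
Qed.

Lemma measurable_nu_tilde : measurable_fun setT (nu_tilde nu B).
Proof.
apply/measurable_EFinP.
rewrite (_ : _ \o _ = fubini_F mu (fun z : E * E => (\1_B z.2 * j (z.1 - z.2))%:E)); last first.
  apply/funext => x; rewrite /= nu_tildeE integral_mkcond; apply: eq_integral => y _.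
  by rewrite /patch /= indicE; case: ifP => _; rewrite ?mul1r ?mul0r.
apply: measurable_fun_fubini_tonelli_F.
  apply/measurable_EFinP; apply: measurable_funM.
    by apply: (measurableT_comp _ measurable_snd); exact: measurable_indic.
  exact: (measurableT_comp mj measurable_sub_rV).
by move=> z; rewrite lee_fin mulr_ge0 ?trunc_density_ge0.
Qed.

End nonlocal_weight.

(** * Quadratic forms in differences *)

Section difference_form.
Context {R : realType} (n : nat).
Local Notation E := 'rV[R]_n.
Local Notation mu := (@lebesgue_rV R n).
Local Notation mumu := (mu \x mu)%E.
Implicit Types (kappa : E * E -> R) (u v : E -> R).

(** The square root of the kernel presents the quadratic form as a square norm on the
    product space, so that bilinearity and the Cauchy-Schwarz inequality are inherited
    from there. *)
Definition diffk kappa u (z : E * E) : R := (u z.1 - u z.2) * Num.sqrt (kappa z).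

Definition diffsq kappa u : \bar R := sqnorm mumu (diffk kappa u).

Lemma measurable_sqrtr_comp d (T : measurableType d) (f : T -> R) :
  measurable_fun setT f -> measurable_fun setT (fun x => Num.sqrt (f x)).
Proof.
move=> mf; apply: (measurableT_comp _ mf).
by apply: continuous_measurable_fun => x; exact: sqrt_continuous.
Qed.

Lemma measurable_diff u : measurable_fun setT u ->
  measurable_fun setT (fun z : E * E => u z.1 - u z.2).
Proof.
move=> mfu; apply: measurable_funB.
  exact: (measurableT_comp mfu measurable_fst).
exact: (measurableT_comp mfu measurable_snd).
Qed.

Lemma measurable_diffk kappa u : measurable_fun setT kappa -> measurable_fun setT u ->
  measurable_fun setT (diffk kappa u).
Proof.
move=> mk mfu; apply: measurable_funM; first exact: measurable_diff.
exact: measurable_sqrtr_comp.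
Qed.

Lemma diffk_sqr kappa u z : 0 <= kappa z ->
  diffk kappa u z ^+ 2 = (u z.1 - u z.2) ^+ 2 * kappa z.
Proof. by move=> k0; rewrite /diffk exprMn sqr_sqrtr. Qed.

Lemma diffk_comb kappa s t u v :
  diffk kappa (fun x => s * u x + t * v x) =
  (fun z => s * diffk kappa u z + t * diffk kappa v z).
Proof. by apply/funext => z; rewrite /diffk; ring. Qed.

Lemma diffsqE kappa u : (forall z, 0 <= kappa z) ->
  diffsq kappa u = (\int[mumu]_z ((u z.1 - u z.2) ^+ 2 * kappa z)%:E)%E.
Proof. by move=> k0; apply: eq_integral => z _; rewrite diffk_sqr. Qed.

Lemma diffsq_le kappa kappa' c u : 0 <= c ->
  measurable_fun setT kappa -> measurable_fun setT kappa' -> measurable_fun setT u ->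
  (forall z, 0 <= kappa z <= c * kappa' z) -> (forall z, 0 <= kappa' z) ->
  (diffsq kappa u <= c%:E * diffsq kappa' u)%E.
Proof.
move=> c0 mk mk' mfu kk k'0.
rewrite /diffsq /sqnorm -ge0_integralZl_EFin //; last 2 first.
- by move=> z _; rewrite lee_fin sqr_ge0.
- by apply: measurable_sqr; exact: measurable_diffk.
apply: ge0_le_integral => //.
- by move=> z _; rewrite lee_fin sqr_ge0.
- by apply: measurable_sqr; exact: measurable_diffk.
- by apply: measurable_funeM; apply: measurable_sqr; exact: measurable_diffk.
- move=> z _; have /andP[k0 kc] := kk z.
  rewrite -EFinM lee_fin !diffk_sqr // mulrCA.
  by apply: ler_wpM2l => //; exact: sqr_ge0.
Qed.

Lemma diffsqD kappa kappa' u :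
  measurable_fun setT kappa -> measurable_fun setT kappa' -> measurable_fun setT u ->
  (forall z, 0 <= kappa z) -> (forall z, 0 <= kappa' z) ->
  diffsq (fun z => kappa z + kappa' z) u = (diffsq kappa u + diffsq kappa' u)%E.
Proof.
move=> mk mk' mfu k0 k'0; rewrite /diffsq /sqnorm -ge0_integralD //.
- apply: eq_integral => z _; rewrite -EFinD; congr EFin.
  by rewrite !diffk_sqr ?addr_ge0 // mulrDr.
- by move=> z _; rewrite lee_fin sqr_ge0.
- by apply: measurable_sqr; exact: measurable_diffk.
- by move=> z _; rewrite lee_fin sqr_ge0.
- by apply: measurable_sqr; exact: measurable_diffk.
Qed.

Lemma measurable_swap_rV : measurable_fun setT (fun z : E * E => (z.2, z.1)).
Proof. by apply: measurable_fun_pair; [exact: measurable_snd|exact: measurable_fst]. Qed.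

Lemma diffsq_swap kappa u :
  measurable_fun setT kappa -> measurable_fun setT u -> (forall z, 0 <= kappa z) ->
  diffsq (fun z => kappa (z.2, z.1)) u = diffsq kappa u.
Proof.
move=> mk mfu k0; rewrite !diffsqE //.
have mf : measurable_fun setT (fun z : E * E => ((u z.1 - u z.2) ^+ 2 * kappa z)%:E).
  apply/measurable_EFinP; apply: measurable_funM => //.
  by apply: measurable_funX; exact: measurable_diff.
rewrite fubini_tonelli1; last 2 first.
- apply/measurable_EFinP; apply: measurable_funM.
    by apply: measurable_funX; exact: measurable_diff.
  exact: (measurableT_comp mk measurable_swap_rV).
- by move=> z; rewrite lee_fin mulr_ge0 ?sqr_ge0.
have f0 (z : E * E) : (0 <= ((u z.1 - u z.2) ^+ 2 * kappa z)%:E)%E.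
  by rewrite lee_fin mulr_ge0 ?sqr_ge0.
rewrite (fubini_tonelli2 _ mf f0); apply: eq_integral => x _; apply: eq_integral => y _ /=.
by rewrite -(opprB (u y)) sqrrN.
Qed.

Lemma product_null (N : set E) : measurable N -> mu N = 0%E ->
  mumu (N `*` setT `|` setT `*` N) = 0%E.
Proof.
move=> mN N0.
have NT : mumu (N `*` setT) = (mu N * mu setT)%E by exact: product_measure1E.
have TN : mumu (setT `*` N) = (mu setT * mu N)%E by exact: product_measure1E.
apply: null_set_setU; [exact: measurableX|exact: measurableX|..].
- by apply: etrans NT _; rewrite N0 mul0e.
- by apply: etrans TN _; rewrite N0 mule0.
Qed.

Lemma diffsq_ae kappa u v (N : set E) :
  measurable_fun setT kappa -> measurable_fun setT u -> measurable_fun setT v ->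
  measurable N -> mu N = 0%E -> (forall x, ~ N x -> u x = v x) ->
  diffsq kappa u = diffsq kappa v.
Proof.
move=> mk mfu mv mN N0 uv.
have mNN : measurable (N `*` setT `|` setT `*` N : set (E * E)).
  by apply: measurableU; exact: measurableX.
apply: ge0_ae_eq_integral => //.
- by apply: measurable_sqr; exact: measurable_diffk.
- by apply: measurable_sqr; exact: measurable_diffk.
- by move=> z _; rewrite lee_fin sqr_ge0.
- by move=> z _; rewrite lee_fin sqr_ge0.
exists (N `*` setT `|` setT `*` N); split => //; first exact: product_null.
move=> z /= H; apply: contrapT => zN; apply: H => _.
rewrite /diffk !uv //; move=> Nz; apply: zN; [by right|by left].
Qed.

End difference_form.

(** * The seminorm, the energy and the exterior values *)

Section neumann_forms.
Context {R : realType} (n : nat).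
Local Notation E := 'rV[R]_n.+1.
Local Notation mu := (@lebesgue_rV R n.+1).
Local Notation mumu := (mu \x mu)%E.
Variables (Omega B : set E) (nu : E -> R) (Lambda M : R).
Hypothesis openO : open Omega.
Hypothesis OM : Omega `<=` [set x | `|x| <= M].
Hypothesis levy_nu : levy_density nu.
Hypothesis full_nu : full_support nu.
Hypothesis openB : open B.
Hypothesis B0 : B !=set0.
Hypothesis BO : B `<=` Omega.
Hypothesis L1 : 1 <= Lambda.
Implicit Types u v : E -> R.
Local Notation nu0 := (offdiag_density nu).
Local Notation j := (trunc_density nu).

Let mO : measurable Omega. Proof. exact: open_measurable_rV. Qed.
Let mB : measurable B. Proof. exact: open_measurable_rV. Qed.
Let BM : B `<=` [set x | `|x| <= M]. Proof. exact: subset_trans OM. Qed.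
Let mj := measurable_trunc_density levy_nu.
Let mnu0 := measurable_offdiag_density levy_nu.
Let nu00 := offdiag_density_ge0 levy_nu.
Let j0 := trunc_density_ge0 levy_nu.
Let Lambda_gt0 : 0 < Lambda. Proof. exact: lt_le_trans L1. Qed.

Definition semi_kernel (z : E * E) : R := \1_Omega z.1 * nu0 (z.1 - z.2).

Definition energy_kernel (k : E -> E -> R) (z : E * E) : R :=
  if z.1 == z.2 then 0 else \1_(~` (~` Omega `*` ~` Omega)) z * k z.1 z.2.

Local Notation semi := (diffsq semi_kernel).

Lemma measurable_semi_kernel : measurable_fun setT semi_kernel.
Proof.
apply: measurable_funM.
  by apply: (measurableT_comp _ measurable_fst); exact: measurable_indic.
exact: (measurableT_comp mnu0 (@measurable_sub_rV _ _)).
Qed.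

Lemma semi_kernel_ge0 z : 0 <= semi_kernel z.
Proof. by rewrite /semi_kernel mulr_ge0. Qed.

Let integrand (p : E -> R) (u : E -> R) (z : E * E) := ((u z.1 - u z.2) ^+ 2 * p (z.1 - z.2))%:E.

Let mintegrand p u : measurable_fun setT p -> measurable_fun setT u ->
  measurable_fun setT (integrand p u).
Proof.
move=> mp mfu; apply/measurable_EFinP; apply: measurable_funM.
  by apply: measurable_funX; exact: measurable_diff.
exact: (measurableT_comp mp (@measurable_sub_rV _ _)).
Qed.

Let integrand_ge0 (p : E -> R) u z : (forall h, 0 <= p h) -> (0 <= integrand p u z)%E.
Proof. by move=> p0; rewrite lee_fin mulr_ge0 ?sqr_ge0. Qed.

Lemma semi_iterated u : measurable_fun setT u ->
  semi u = (\int[mu]_(x in Omega) \int[mu]_y integrand nu0 u (x, y))%E.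
Proof.
move=> mfu; rewrite diffsqE; last exact: semi_kernel_ge0.
rewrite fubini_tonelli1; last 2 first.
- apply/measurable_EFinP; apply: measurable_funM; last exact: measurable_semi_kernel.
  by apply: measurable_funX; exact: measurable_diff.
- by move=> z; rewrite lee_fin mulr_ge0 ?sqr_ge0 ?semi_kernel_ge0.
rewrite [RHS]integral_mkcond; apply: eq_integral => x _.
rewrite /fubini_F /patch /semi_kernel /= indicE; case: ifPn => xO.
  by apply: eq_integral => y _; rewrite mul1r.
by apply: integral0_eq => y _; rewrite mul0r mulr0.
Qed.

Lemma VsemisqE u : measurable_fun setT u -> Vsemisq nu Omega u = semi u.
Proof.
move=> mfu; rewrite (semi_iterated mfu).
apply: eq_integral => x _; apply: eq_integral => y _.
rewrite /integrand /= /offdiag_density; case: eqP => // /eqP.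
by rewrite subr_eq0 => /eqP ->; rewrite subrr expr0n !mul0r.
Qed.

Lemma VspaceE u : Vspace nu Omega u <->
  [/\ measurable_fun setT u, (L2sq Omega u < +oo)%E & (semi u < +oo)%E].
Proof. by split=> -[mfu l2 s]; split => //; [rewrite -VsemisqE|rewrite VsemisqE]. Qed.

(** The seminorm is an integral over starting points in [Omega] of jumps into the whole
    space, as is the local variation for the smaller kernel [j]. *)
Lemma integral_local_var_le u : measurable_fun setT u ->
  (\int[mu]_(x in Omega) local_var j u x <= semi u)%E.
Proof.
move=> mfu; rewrite (semi_iterated mfu).
have lE x : local_var j u x = (\int[mu]_y integrand j u (x, y))%E.
  by apply: eq_integral => y _; rewrite /integrand /= -(trunc_densityN levy_nu) opprB.
apply: ge0_le_integral => //.
- by move=> x _; exact: (local_var_ge0 (trunc_density01 levy_nu)).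
- by apply: measurable_funTS; exact: (measurable_local_var mj (trunc_density01 levy_nu)).
- apply: measurable_funTS.
  have := @measurable_fun_fubini_tonelli_F _ _ _ _ _ mu (integrand nu0 u) (mintegrand mnu0 mfu).
  by apply=> z; exact: integrand_ge0.
move=> x _; rewrite lE; apply: ge0_le_integral => //.
- by move=> y _; exact: integrand_ge0.
- exact: (measurableT_comp (mintegrand mj mfu) (measurable_pair1 x)).
- exact: (measurableT_comp (mintegrand mnu0 mfu) (measurable_pair1 x)).
- move=> y _; rewrite lee_fin; apply: ler_wpM2l; first exact: sqr_ge0.
  exact: trunc_density_le.
Qed.

Section elliptic.
Variable k : E -> E -> R.
Hypothesis ell : elliptic_kernel nu Lambda k.

Let mA : measurable (~` (~` Omega `*` ~` Omega) : set (E * E)).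
Proof. by apply: measurableC; apply: measurableX; exact: measurableC. Qed.

Lemma measurable_energy_kernel : measurable_fun setT (energy_kernel k).
Proof.
have [mk _ _ _] := ell.
have mD : measurable [set z : E * E | z.1 != z.2].
  rewrite (_ : [set z | _] = (fun z : E * E => z.1 - z.2) @^-1` [set~ 0]).
    rewrite -[X in measurable X]setTI; apply: measurable_sub_rV => //.
    by apply: measurableC; exact: measurable_set1_rV.
  apply/seteqP; split => z /=; first by move=> /eqP h /eqP; rewrite subr_eq0 => /eqP.
  by move=> h; apply/eqP => z12; apply: h; rewrite z12 subrr.
rewrite (_ : energy_kernel k = (fun z => \1_(~` (~` Omega `*` ~` Omega)) z *
    ((fun z => k z.1 z.2) \_ [set z : E * E | z.1 != z.2]) z)).
  apply: measurable_funM; first exact: measurable_indic.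
  exact: (measurable_restrictT _ mD).1.
apply/funext => z; rewrite /energy_kernel /patch.
by case: ifPn => z12; [rewrite memNset ?mulr0 //= z12|rewrite mem_set].
Qed.

Lemma energy_kernel_ge0 z : 0 <= energy_kernel k z.
Proof.
have [_ k0 _ _] := ell; rewrite /energy_kernel; case: ifPn => // z12.
by rewrite mulr_ge0 // k0.
Qed.

Lemma energyE u v : energy k Omega u v =
  2^-1 * ip mumu (diffk (energy_kernel k) u) (diffk (energy_kernel k) v).
Proof.
rewrite /energy Rintegral_mkcond; congr (_ * _); apply: eq_Rintegral => z _.
rewrite /diffk mulrACA -expr2 sqr_sqrtr ?energy_kernel_ge0 // /patch /energy_kernel indicE.
case: ifP => _; last by case: ifP => _; rewrite ?mul0r mulr0.
by case: ifPn => [/eqP ->|]; rewrite ?mul1r // !subrr !mul0r.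
Qed.

(** Every pair counted by the energy has an end point in [Omega], so up to the
    ellipticity constant the energy is at most the seminorm plus its mirror image. *)
Lemma energy_le_semi u : measurable_fun setT u ->
  (diffsq (energy_kernel k) u <= (2 * Lambda)%:E * semi u)%E.
Proof.
move=> mfu; have ms := measurable_semi_kernel.
have msw : measurable_fun setT (fun z : E * E => semi_kernel (z.2, z.1)).
  exact: (measurableT_comp ms (@measurable_swap_rV _ _)).
pose both (z : E * E) := semi_kernel z + semi_kernel (z.2, z.1).
have : (diffsq (energy_kernel k) u <= Lambda%:E * diffsq both u)%E.
  apply: diffsq_le => //; first exact: ltW.
  - exact: measurable_energy_kernel.
  - exact: measurable_funD.
  - move=> z; rewrite energy_kernel_ge0 /both /= /energy_kernel.
    case: ifPn => z12; first by rewrite mulr_ge0 ?addr_ge0 ?semi_kernel_ge0 // ltW.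
    have [_ k0 _ /(_ _ _ z12)/andP[_ kL]] := ell.
    rewrite /semi_kernel /= !indicE -[nu0 (z.2 - z.1)]offdiag_densityN // opprB -mulrDl mulrA.
    have -> : nu0 (z.1 - z.2) = nu (z.2 - z.1).
      by rewrite -offdiag_densityN // opprB /offdiag_density subr_eq0 eq_sym (negbTE z12).
    have nz : 0 <= nu (z.2 - z.1).
      by have [_ + _ _] := levy_nu; apply; rewrite subr_eq0 eq_sym.
    have [zA|zA] := boolP (z \in ~` (~` Omega `*` ~` Omega)); last first.
      by rewrite mul0r !mulr_ge0 // ?addr_ge0 // ltW.
    rewrite mul1r; apply: le_trans kL _; apply: ler_wpM2r => //.
    apply: ler_peMr; first exact: ltW.
    have [z1|z1] := boolP (z.1 \in Omega); first by rewrite lerDl.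
    have [z2|z2] := boolP (z.2 \in Omega); first by rewrite lerDr.
    move: zA; rewrite inE => -[].
    by split => /= h; [move/negP: z1|move/negP: z2]; apply; rewrite inE.
  - by move=> z; rewrite addr_ge0 ?semi_kernel_ge0.
move=> /le_trans; apply; rewrite diffsqD // ?diffsq_swap //; try exact: semi_kernel_ge0.
- by rewrite mulrC EFinM -muleA -mule2n mule_natl.
- by move=> z; exact: semi_kernel_ge0.
Qed.

Lemma semi_le_energy u : measurable_fun setT u ->
  (semi u <= Lambda%:E * diffsq (energy_kernel k) u)%E.
Proof.
move=> mfu; have ms := measurable_semi_kernel; have mk := measurable_energy_kernel.
apply: (@le_trans _ _ (diffsq (fun z => if z.1 == z.2 then 0 else semi_kernel z) u)).
  rewrite le_eqVlt; apply/orP; left; apply/eqP; apply: eq_integral => z _.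
  rewrite /diffk; case: ifPn => // /eqP ->; by rewrite subrr !mul0r.
apply: diffsq_le => //; first exact: ltW.
- rewrite (_ : (fun z => _) = semi_kernel) //; apply/funext => z.
  by case: eqP => // z12; rewrite /semi_kernel z12 subrr /offdiag_density eqxx mulr0.
- move=> z; rewrite /energy_kernel; case: ifPn => z12; first by rewrite mulr0 lexx.
  rewrite semi_kernel_ge0 /=; have [_ k0 _ /(_ _ _ z12)/andP[kL _]] := ell.
  rewrite /semi_kernel !indicE.
  have [z1|z1] := boolP (z.1 \in Omega); last first.
    by rewrite mul0r !mulr_ge0 ?k0 // ltW.
  have -> : (z \in ~` (~` Omega `*` ~` Omega)) = true.
    by apply: mem_set => -[/= zO _]; apply: zO; exact: set_mem.
  rewrite !mul1r -offdiag_densityN // opprB /offdiag_density subr_eq0 eq_sym (negbTE z12).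
  by rewrite -ler_pdivrMl.
- exact: energy_kernel_ge0.
Qed.

End elliptic.

Local Notation J := (\int[mu]_h (j h)%:E)%E.

Definition exterior_sq (u : E -> R) : \bar R := \int[mu]_y (u y ^+ 2 * nu_tilde nu B y)%:E.

Lemma measurable_exterior u : measurable_fun setT u ->
  measurable_fun setT (fun y : E => (u y ^+ 2 * nu_tilde nu B y)%:E).
Proof.
move=> mfu; apply/measurable_EFinP; apply: measurable_funM; first exact: measurable_funX.
exact: (measurable_nu_tilde levy_nu openB BM).
Qed.

(** The values outside are controlled by averaging, over the starting points [x] in
    [B], the bound of [u y ^+ 2] by [2 * (u x - u y) ^+ 2 + 2 * u x ^+ 2]. *)
Lemma exterior_le u : measurable_fun setT u ->
  (exterior_sq u <= 2%:E * semi u + 2%:E * (J * L2sq Omega u))%E.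
Proof.
move=> mfu; have ms := measurable_semi_kernel.
pose f (z : E * E) := (u z.2 ^+ 2 * (\1_B z.1 * j (z.1 - z.2)))%:E.
pose g (z : E * E) := (u z.1 ^+ 2 * (\1_Omega z.1 * j (z.1 - z.2)))%:E.
have mind (D : set E) : measurable D ->
    measurable_fun setT (fun z : E * E => \1_D z.1 * j (z.1 - z.2)).
  move=> mD; apply: measurable_funM.
    by apply: (measurableT_comp _ measurable_fst); exact: measurable_indic.
  exact: (measurableT_comp mj (@measurable_sub_rV _ _)).
have ind0 (D : set E) z : 0 <= \1_D z.1 * j (z.1 - z.2) by rewrite mulr_ge0.
have f0 z : (0 <= f z)%E by rewrite lee_fin mulr_ge0 ?sqr_ge0.
have g0 z : (0 <= g z)%E by rewrite lee_fin mulr_ge0 ?sqr_ge0.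
have mf : measurable_fun setT f.
  apply/measurable_EFinP; apply: measurable_funM; last exact: mind.
  by apply: measurable_funX; exact: (measurableT_comp mfu measurable_snd).
have mg : measurable_fun setT g.
  apply/measurable_EFinP; apply: measurable_funM; last exact: mind.
  by apply: measurable_funX; exact: (measurableT_comp mfu measurable_fst).
have -> : exterior_sq u = (\int[mumu]_z f z)%E.
  rewrite fubini_tonelli2 //; apply: eq_integral => y _.
  rewrite EFinM (nu_tildeE levy_nu openB BM) integral_mkcond -ge0_integralZl_EFin ?sqr_ge0 //.
  - apply: eq_integral => x _; rewrite /f /patch /= indicE.
    case: ifP => _; last by rewrite mul0r mulr0 mule0.
    by rewrite mul1r -EFinM -[j (x - y)]trunc_densityN // opprB.
  - by move=> x _; apply: erestrict_ge0 => ? _; rewrite lee_fin.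
  - apply: (measurable_restrictT _ mB).1; apply: measurable_funTS; apply/measurable_EFinP.
    apply: (measurableT_comp mj); apply/measurable_fun_rVP => i; under eq_fun do rewrite !mxE.
    by apply: measurable_funB => //; exact: measurable_coord.
have gE : (\int[mumu]_z g z = J * L2sq Omega u)%E.
  rewrite fubini_tonelli1 // /L2sq [X in (_ * X)%E]integral_mkcond -ge0_integralZl //.
  - apply: eq_integral => x _; rewrite /fubini_F /g /patch /= indicE.
    case: ifP => _; last by rewrite mule0; apply: integral0_eq => y _; rewrite mul0r mulr0.
    rewrite -[X in (X * _)%E](ge0_integral_translate (- x)); last 2 first.
    + exact/measurable_EFinP.
    + by move=> h; rewrite lee_fin.
    rewrite muleC -ge0_integralZl_EFin ?sqr_ge0 //.
    + by apply: eq_integral => y _; rewrite mul1r -EFinM -[j (x - y)]trunc_densityN // opprB.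
    + by move=> y _; rewrite lee_fin.
    + apply/measurable_EFinP; exact: (measurableT_comp mj (measurable_subr_rV x)).
  - apply: (measurable_restrictT _ mO).1; apply: measurable_funTS; exact: measurable_sqr.
  - by move=> x _; apply: erestrict_ge0 => ? _; rewrite lee_fin sqr_ge0.
  - by apply: integral_ge0 => h _; rewrite lee_fin.
have p0 z : (0 <= ((u z.1 - u z.2) ^+ 2 * semi_kernel z)%:E)%E.
  by rewrite lee_fin mulr_ge0 ?sqr_ge0 ?semi_kernel_ge0.
have mp : measurable_fun setT (fun z => ((u z.1 - u z.2) ^+ 2 * semi_kernel z)%:E).
  apply/measurable_EFinP; apply: measurable_funM => //.
  by apply: measurable_funX; exact: measurable_diff.
rewrite -gE diffsqE; last exact: semi_kernel_ge0.
rewrite -!ge0_integralZl_EFin // -ge0_integralD //; last 4 first.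
- by move=> z _; rewrite mule_ge0.
- exact: measurable_funeM.
- by move=> z _; rewrite mule_ge0.
- exact: measurable_funeM.
apply: ge0_le_integral => //.
- by apply: emeasurable_funD; exact: measurable_funeM.
move=> z _; rewrite -!EFinM -EFinD lee_fin /semi_kernel !indicE.
have [zB|zB] := boolP (z.1 \in B); last first.
  rewrite mul0r mulr0; apply: addr_ge0; apply: mulr_ge0 => //; apply: mulr_ge0;
    rewrite ?sqr_ge0 // mulr_ge0 //.
rewrite (_ : z.1 \in Omega) /=; last by apply: mem_set; apply: BO; exact: set_mem.
rewrite !mul1r.
apply: (@le_trans _ _ ((2 * (u z.1 - u z.2) ^+ 2 + 2 * u z.1 ^+ 2) * j (z.1 - z.2))).
  apply: ler_wpM2r => //.
  by have := sqr_ge0 (2 * u z.1 - u z.2); lra.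
rewrite mulrDl [X in _ <= _ + X]mulrA lerD2r [leRHS]mulrA.
by apply: ler_wpM2l; [rewrite mulr_ge0 ?sqr_ge0|exact: trunc_density_le].
Qed.

End neumann_forms.

(** * The solution space and the data functional *)

Section solution_space.
Context {R : realType} (n : nat).
Local Notation E := 'rV[R]_n.+1.
Local Notation mu := (@lebesgue_rV R n.+1).
Local Notation mumu := (mu \x mu)%E.
Variables (Omega B : set E) (nu : E -> R) (M : R).
Hypothesis openO : open Omega.
Hypothesis OM : Omega `<=` [set x | `|x| <= M].
Hypothesis levy_nu : levy_density nu.
Hypothesis full_nu : full_support nu.
Hypothesis openB : open B.
Hypothesis B0 : B !=set0.
Hypothesis BO : B `<=` Omega.
Implicit Types u v f g : E -> R.
Local Notation j := (trunc_density nu).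
Local Notation semi := (diffsq (semi_kernel Omega nu)).
Local Notation W := (diffk (semi_kernel Omega nu)).
Local Notation ext := (exterior_sq B nu).
Local Notation nt := (nu_tilde nu B).

Let mO : measurable Omega. Proof. exact: open_measurable_rV. Qed.
Let mOc : measurable (~` Omega). Proof. exact: measurableC. Qed.
Let BM : B `<=` [set x | `|x| <= M]. Proof. exact: subset_trans OM. Qed.
Let Ooo : (mu Omega < +oo)%E.
Proof. exact: (bounded_finite_measure openO OM). Qed.
Let mnt : measurable_fun setT nt. Proof. exact: (measurable_nu_tilde levy_nu openB BM). Qed.
Let nt0 x : 0 < nt x. Proof. exact: (nu_tilde_gt0 levy_nu full_nu openB B0 BM). Qed.

Lemma measurable_W u : measurable_fun setT u -> measurable_fun setT (W u).
Proof. by move=> mfu; apply: measurable_diffk => //; exact: measurable_semi_kernel. Qed.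

Lemma Vspace_sqint u : Vspace nu Omega u <->
  [/\ measurable_fun setT u, sqint mu (u \_ Omega) & sqint mumu (W u)].
Proof.
rewrite VspaceE //; split=> -[mfu l2 s]; split => //.
- by apply: sqint_patch => //; exact: measurable_funTS.
- by split=> //; exact: measurable_W.
- by rewrite /L2sq sqnorm_patch; exact: l2.2.
- exact: s.2.
Qed.

Lemma patch_comb (D : set E) s t u v :
  (fun x => s * u x + t * v x) \_ D = (fun x => s * (u \_ D) x + t * (v \_ D) x).
Proof. by apply/funext => x; rewrite /patch; case: ifP => // _; rewrite !mulr0 addr0. Qed.

Lemma Vspace_comb s t u v : Vspace nu Omega u -> Vspace nu Omega v ->
  Vspace nu Omega (fun x => s * u x + t * v x).
Proof.
move=> /Vspace_sqint[mfu lu su] /Vspace_sqint[mv lv sv]; apply/Vspace_sqint; split.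
- by apply: measurable_funD; apply: measurable_funM.
- by rewrite patch_comb; exact: sqintD.
- by rewrite diffk_comb; exact: sqintD.
Qed.

Lemma integral_ip u : \int[mu]_(x in Omega) u x = ip mu (u \_ Omega) ((cst 1 : E -> R) \_ Omega).
Proof. by rewrite ip_patch; apply: eq_Rintegral => x _; rewrite /= mulr1. Qed.

Lemma integral_comb s t u v : Vspace nu Omega u -> Vspace nu Omega v ->
  \int[mu]_(x in Omega) (s * u x + t * v x) =
  s * \int[mu]_(x in Omega) u x + t * \int[mu]_(x in Omega) v x.
Proof.
move=> /Vspace_sqint[mfu lu su] /Vspace_sqint[mv lv sv].
rewrite !integral_ip patch_comb ipDl //; exact: sqint_cst_patch.
Qed.

Lemma Vperp_comb s t u v : Vperp nu Omega u -> Vperp nu Omega v ->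
  Vperp nu Omega (fun x => s * u x + t * v x).
Proof.
move=> [Vu u0] [Vv v0]; split; first exact: Vspace_comb.
by rewrite integral_comb // u0 v0 !mulr0 addr0.
Qed.

Lemma Vspace_cst c : Vspace nu Omega (cst c).
Proof.
apply/Vspace_sqint; split; first exact: measurable_cst.
  exact: sqint_cst_patch.
have -> : W (cst c) = cst 0 by apply/funext => z; rewrite /diffk /= subrr mul0r.
split; first exact: measurable_cst.
by rewrite /sqnorm integral0_eq // => z _; rewrite /= expr0n.
Qed.

(** On mean-zero functions the seminorm dominates the square norm in [Omega], by the
    Poincare inequality, and hence the weighted square norm on the whole space. *)
Lemma mean_zero_estimate : exists2 K : R, 0 < K & forall u, Vperp nu Omega u ->
  (L2sq Omega u <= K%:E * semi u)%E /\ (ext u <= K%:E * semi u)%E.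
Proof.
have mj := measurable_trunc_density levy_nu.
have j01 := trunc_density01 levy_nu.
have j_open := integral_trunc_density_open levy_nu full_nu.
have [b Bb] := B0.
have /nbhs_ballP[rho /= rho0 rhoB] : nbhs b B by exact: open_nbhs_nbhs.
have [C C0 poinc] := nonlocal_poincare mj j01 j_open mO OM rho0 (subset_trans rhoB BO).
pose J := fine (\int[mu]_h (j h)%:E)%E.
have J0 : 0 <= J by rewrite fine_ge0 // integral_ge0 // => h _; rewrite lee_fin trunc_density_ge0.
have JE : (\int[mu]_h (j h)%:E)%E = J%:E.
  rewrite fineK // ge0_fin_numE; first exact: integral_trunc_density.
  by apply: integral_ge0 => h _; rewrite lee_fin trunc_density_ge0.
exists (C + (2 + 2 * (J * C))); first by rewrite addr_gt0 // ltr_wpDr // !mulr_ge0 // ltW.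
move=> u [Vu u0]; have [mfu l2 sf] := (VspaceE openO levy_nu u).1 Vu.
have s0 : (0 <= semi u)%E by exact: sqnorm_ge0.
have lC : (L2sq Omega u <= C%:E * semi u)%E.
  apply: le_trans (poinc u mfu l2 u0) _; apply: lee_wpmul2l; first by rewrite lee_fin ltW.
  exact: integral_local_var_le.
split.
  apply: le_trans lC _; apply: lee_wpmul2r => //.
  by rewrite lee_fin lerDl addr_ge0 // !mulr_ge0 // ltW.
apply: le_trans (exterior_le openO OM levy_nu openB BO mfu) _.
rewrite JE; apply: (@le_trans _ _ (2%:E * semi u + 2%:E * (J%:E * (C%:E * semi u)))%E).
  by rewrite leeD2l // lee_wpmul2l // lee_wpmul2l.
have C0' := ltW C0; have JC0 : 0 <= 2 * (J * C) by rewrite !mulr_ge0.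
rewrite !muleA -!EFinM -mulrA -ge0_muleDl ?lee_fin //.
by apply: lee_wpmul2r => //; rewrite -EFinD lee_fin lerDr.
Qed.

Lemma exterior_fin u : Vspace nu Omega u -> (ext u < +oo)%E.
Proof.
move=> Vu; have [mfu l2 sf] := (VspaceE openO levy_nu u).1 Vu.
apply: le_lt_trans (exterior_le openO OM levy_nu openB BO mfu) _.
have J0 : (0 <= \int[mu]_h (j h)%:E)%E.
  by apply: integral_ge0 => h _; rewrite lee_fin trunc_density_ge0.
have Jfin : (\int[mu]_h (j h)%:E)%E \is a fin_num.
  by rewrite ge0_fin_numE //; exact: integral_trunc_density.
apply: lte_add_pinfty; first exact: lte_mul_pinfty.
by apply: lte_mul_pinfty => //; exact: lte_mul_pinfty.
Qed.

Definition load f g v : R :=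
  \int[mu]_(x in Omega) (f x * v x) + \int[mu]_(y in ~` Omega) (g y * v y).

Let ws v := (fun y => v y * Num.sqrt (nt y)) \_ (~` Omega).
Let wd g := (fun y => g y / Num.sqrt (nt y)) \_ (~` Omega).

Let sq0 y : 0 < Num.sqrt (nt y). Proof. by rewrite sqrtr_gt0. Qed.

Let msq : measurable_fun setT (fun y => Num.sqrt (nt y)).
Proof. exact: measurable_sqrtr_comp. Qed.

Let mws v : measurable_fun setT v -> measurable_fun (~` Omega) (fun y => v y * Num.sqrt (nt y)).
Proof. by move=> mv; apply: measurable_funTS; exact: measurable_funM. Qed.

Let ws_le v : measurable_fun setT v -> (sqnorm mu (ws v) <= ext v)%E.
Proof.
move=> mv; rewrite -sqnorm_patch /exterior_sq.
rewrite (eq_integral (fun y => (v y ^+ 2 * nt y)%:E)); last first.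
  by move=> y _; rewrite exprMn sqr_sqrtr // ltW.
apply: ge0_subset_integral => //; first exact: (measurable_exterior OM).
by move=> y _; rewrite lee_fin mulr_ge0 ?sqr_ge0 // ltW.
Qed.

Let sqint_ws v : Vspace nu Omega v -> sqint mu (ws v).
Proof.
move=> Vv; have [mv _ _] := Vv; split; last exact: le_lt_trans (ws_le mv) (exterior_fin Vv).
by apply: (measurable_restrictT _ mOc).1; exact: mws.
Qed.

Let sqnorm_wd g : sqnorm mu (wd g) = wL2sq (~` Omega) (fun x => (nt x)^-1) g.
Proof.
rewrite -sqnorm_patch; apply: eq_integral => y _.
by rewrite exprMn exprVn sqr_sqrtr // ltW.
Qed.

Let sqint_wd g : wL2 (~` Omega) (fun x => (nt x)^-1) g -> sqint mu (wd g).
Proof.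
move=> [mg g2]; split; last by rewrite sqnorm_wd.
apply: (measurable_restrictT _ mOc).1.
rewrite (_ : (fun y => _) = (fun y => g y * Num.sqrt ((nt y)^-1))); last first.
  by apply/funext => y; rewrite sqrtrV // ltW.
apply: measurable_funM => //; apply: measurable_funTS; apply: measurable_sqrtr_comp.
rewrite (_ : (fun y => _) = (fun y => nt y `^ (-1))).
  exact: (measurableT_comp (measurable_powR _) mnt).
by apply/funext => y; rewrite powR_inv1 // ltW.
Qed.

Let load_ip f g v : load f g v = ip mu (f \_ Omega) (v \_ Omega) + ip mu (wd g) (ws v).
Proof.
rewrite /load !ip_patch; congr (_ + _); apply: eq_Rintegral => y _.
by rewrite mulrACA mulVf ?mulr1 // gt_eqF.
Qed.

Lemma load_comb f g s t u v : L2 Omega f -> wL2 (~` Omega) (fun x => (nt x)^-1) g ->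
  Vspace nu Omega u -> Vspace nu Omega v ->
  load f g (fun x => s * u x + t * v x) = s * load f g u + t * load f g v.
Proof.
move=> [mf f2] g2 Vu Vv; have gw := sqint_wd g2.
have fo := sqint_patch mO mf f2.
have [_ lu _] := (Vspace_sqint u).1 Vu; have [_ lv _] := (Vspace_sqint v).1 Vv.
have -> : load f g (fun x => s * u x + t * v x) =
    ip mu (fun x => s * (u \_ Omega) x + t * (v \_ Omega) x) (f \_ Omega) +
    ip mu (fun x => s * ws u x + t * ws v x) (wd g).
  rewrite load_ip ipC patch_comb (ipC _ (wd g)); congr (_ + ip mu _ _).
  by rewrite -patch_comb; congr (_ \_ _); apply/funext => y; ring.
rewrite !ipDl //; try exact: sqint_ws.
by rewrite !load_ip !(ipC _ (f \_ Omega)) !(ipC _ (wd g)); ring.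
Qed.

(** The Cauchy-Schwarz inequality in [Omega], and in the complement after moving the
    square root of the weight from [v] to [g]. *)
Lemma load_bound f g v : L2 Omega f -> wL2 (~` Omega) (fun x => (nt x)^-1) g ->
  Vspace nu Omega v ->
  load f g v ^+ 2 <=
    2 * (L2norm Omega f + wL2norm (~` Omega) (fun x => (nt x)^-1) g) ^+ 2 *
    (fine (L2sq Omega v) + fine (ext v)).
Proof.
move=> [mf f2] g2 Vv; have gw := sqint_wd g2.
have fo := sqint_patch mO mf f2.
have [mv lv _] := (Vspace_sqint v).1 Vv.
have h1 := cauchy_schwarz fo lv; have h2 := cauchy_schwarz gw (sqint_ws Vv).
rewrite load_ip /L2norm /wL2norm.
have -> : fine (L2sq Omega f) = ip mu (f \_ Omega) (f \_ Omega).
  by rewrite /L2sq sqnorm_patch ip_sqnorm.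
have -> : fine (L2sq Omega v) = ip mu (v \_ Omega) (v \_ Omega).
  by rewrite /L2sq sqnorm_patch ip_sqnorm.
have -> : fine (wL2sq (~` Omega) (fun x => (nt x)^-1) g) = ip mu (wd g) (wd g).
  by rewrite -sqnorm_wd ip_sqnorm.
have h3 : ip mu (ws v) (ws v) <= fine (ext v).
  have ef : ext v \is a fin_num.
    rewrite ge0_fin_numE ?exterior_fin //.
    by apply: integral_ge0 => y _; rewrite lee_fin mulr_ge0 ?sqr_ge0 // ltW.
  by rewrite -lee_fin (fineK ef) -(ip_sqnorm (sqint_ws Vv)) ws_le.
move: h1 h2 h3 (ip_ge0 mu (f \_ Omega)) (ip_ge0 mu (v \_ Omega)) (ip_ge0 mu (wd g))
  (ip_ge0 mu (ws v)).
move: (ip mu (f \_ Omega) (v \_ Omega)) (ip mu (wd g) (ws v)) (ip mu (f \_ Omega) (f \_ Omega))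
  (ip mu (v \_ Omega) (v \_ Omega)) (ip mu (wd g) (wd g)) (ip mu (ws v) (ws v)) (fine (ext v)).
move=> x y a b c d e xab ycd de a0 b0 c0 d0.
have acs : a + c <= (Num.sqrt a + Num.sqrt c) ^+ 2.
  rewrite sqrrD !sqr_sqrtr // addrAC lerDl mulrn_wge0 // mulr_ge0 ?sqrtr_ge0 //.
apply: (@le_trans _ _ (2 * (a + c) * (b + e))); last first.
  by apply: ler_wpM2r; [rewrite addr_ge0 // (le_trans d0)|rewrite ler_wpM2l].
have h : (a + c) * (b + d) <= (a + c) * (b + e) by rewrite ler_wpM2l ?addr_ge0 ?lerD2l.
have ad : 0 <= a * d by exact: mulr_ge0.
have cb : 0 <= c * b by exact: mulr_ge0.
have := sqr_ge0 (x - y).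
rewrite -[2 * _ * _]mulrA; move: h; set Z := (a + c) * (b + e); rewrite mulrDl !mulrDr => h.
rewrite sqrrB sqrrD; lra.
Qed.

End solution_space.

(** * Completeness of the mean-zero space *)

Section completeness.
Context {R : realType} (n : nat).
Local Notation E := 'rV[R]_n.+1.
Local Notation mu := (@lebesgue_rV R n.+1).
Local Notation mumu := (mu \x mu)%E.
Variables (Omega B : set E) (nu : E -> R) (M : R).
Hypothesis openO : open Omega.
Hypothesis OM : Omega `<=` [set x | `|x| <= M].
Hypothesis levy_nu : levy_density nu.
Hypothesis full_nu : full_support nu.
Hypothesis openB : open B.
Hypothesis B0 : B !=set0.
Hypothesis BO : B `<=` Omega.
Implicit Types u v f g : E -> R.
Local Notation semi := (diffsq (semi_kernel Omega nu)).
Local Notation W := (diffk (semi_kernel Omega nu)).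
Local Notation ext := (exterior_sq B nu).
Local Notation nt := (nu_tilde nu B).

Let mO : measurable Omega. Proof. exact: open_measurable_rV. Qed.
Let BM : B `<=` [set x | `|x| <= M]. Proof. exact: subset_trans OM. Qed.
Let Ooo : (mu Omega < +oo)%E.
Proof. exact: (bounded_finite_measure openO OM). Qed.
Let mnt : measurable_fun setT nt. Proof. exact: (measurable_nu_tilde levy_nu openB BM). Qed.
Let nt0 x : 0 < nt x. Proof. exact: (nu_tilde_gt0 levy_nu full_nu openB B0 BM). Qed.

Lemma subr_comb u v : (fun x => u x - v x) = (fun x => 1 * u x + (-1) * v x).
Proof. by apply/funext => x; rewrite mul1r mulN1r. Qed.

Lemma cvg_sqr_EFin (s : nat -> R) (l : R) : s @ \oo --> l ->
  (fun k => (s k ^+ 2)%:E) @ \oo --> (l ^+ 2)%:E.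
Proof.
move=> sl; apply: cvg_EFin; first by near=> k.
by rewrite /comp /=; apply: cvgM.
Unshelve. all: by end_near. Qed.

Lemma integral_sqr_le u : measurable_fun setT u -> (L2sq Omega u < +oo)%E ->
  (\int[mu]_(x in Omega) u x) ^+ 2 <= fine (L2sq Omega u) * fine (mu Omega).
Proof.
move=> mfu u2; have lu := sqint_patch mO (measurable_funTS mfu) u2.
have l1 := sqint_cst_patch mO 1 Ooo.
have -> : fine (L2sq Omega u) = ip mu (u \_ Omega) (u \_ Omega).
  by rewrite /L2sq sqnorm_patch ip_sqnorm.
have -> : fine (mu Omega) = ip mu ((cst 1 : E -> R) \_ Omega) ((cst 1 : E -> R) \_ Omega).
  by rewrite ip_patch /= mul1r Rintegral_cst // mul1r.
by rewrite integral_ip; exact: cauchy_schwarz.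
Qed.

(** A Cauchy sequence for the seminorm is Cauchy for the weight [rho], which is positive
    on the whole space. So it has an almost everywhere convergent subsequence, and by
    the lemma of Fatou the limit is also a limit in the seminorm. *)
Lemma Vperp_complete (u : nat -> E -> R) : (forall k, Vperp nu Omega (u k)) ->
  (forall e : R, 0 < e -> exists N, forall p q, (N <= p)%N -> (N <= q)%N ->
     (semi (fun x => (u p x - u q x)%R) <= e%:E)%E) ->
  exists2 w, Vperp nu Omega w & forall e : R, 0 < e -> exists N, forall p, (N <= p)%N ->
     (semi (fun x => (u p x - w x)%R) <= e%:E)%E.
Proof.
move=> Vu cau.
have [K K0 HK] := mean_zero_estimate openO OM levy_nu full_nu openB B0 BO.
have mfu k : measurable_fun setT (u k) by have [[]] := Vu k.
have Vd p q : Vperp nu Omega (fun x => u p x - u q x).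
  by rewrite subr_comb; exact: (Vperp_comb openO OM levy_nu).
pose rho x : R := \1_Omega x + nt x.
have mrho : measurable_fun setT rho.
  by apply: measurable_funD => //; exact: measurable_indic.
have rho0 x : 0 < rho x by rewrite ltr_wpDl.
have rhoE (d : E -> R) : measurable_fun setT d ->
    (\int[mu]_x (d x ^+ 2 * rho x)%:E = L2sq Omega d + ext d)%E.
  move=> md; rewrite /L2sq [X in (_ = X + _)%E]integral_mkcond -ge0_integralD //.
  - apply: eq_integral => x _; rewrite /patch /rho indicE mulrDr EFinD.
    by case: ifP => _; rewrite ?mulr1 // mulr0.
  - by move=> x _; apply: erestrict_ge0 => ? _; rewrite lee_fin sqr_ge0.
  - by apply: (measurable_restrictT _ mO).1; apply: measurable_funTS; exact: measurable_sqr.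
  - by move=> x _; rewrite lee_fin mulr_ge0 ?sqr_ge0 // ltW.
  - exact: (measurable_exterior OM).
have rcau e : 0 < e -> exists N, forall p q, (N <= p)%N -> (N <= q)%N ->
     (\int[mu]_x ((u p x - u q x) ^+ 2 * rho x)%:E <= e%:E)%E.
  move=> e0; have [|N HN] := cau (e / (2 * K)); first by rewrite divr_gt0 // mulr_gt0.
  exists N => p q Np Nq; rewrite (rhoE (fun x => u p x - u q x)); last exact: measurable_funB.
  have [h1 h2] := HK _ (Vd p q).
  apply: le_trans (leeD h1 h2) _.
  apply: (@le_trans _ _ (K%:E * (e / (2 * K))%:E + K%:E * (e / (2 * K))%:E)%E).
    by apply: leeD; (apply: lee_wpmul2l; [rewrite lee_fin ltW|exact: HN]).
  rewrite -EFinM -EFinD lee_fin le_eqVlt; apply/orP; left; apply/eqP.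
  by field; rewrite gt_eqF.
have [phi [N [w [phik mN N0 mw cvw]]]] := ae_convergent_subsequence mrho rho0 mfu rcau.
(* set to zero on the null set [N], the subsequence converges at every point *)
pose u' k := u (phi k) \_ (~` N).
have mfu' k : measurable_fun setT (u' k).
  by apply: (measurable_restrictT _ (measurableC mN)).1; exact: measurable_funTS.
have u'E k x : ~ N x -> u' k x = u (phi k) x by move=> Nx; rewrite /u' /patch mem_set.
have key e N1 : (forall p q, (N1 <= p)%N -> (N1 <= q)%N ->
     (semi (fun x => (u p x - u q x)%R) <= e%:E)%E) -> forall p, (N1 <= p)%N ->
    (semi (fun x => (u p x - w x)%R) <= e%:E)%E /\
    (L2sq Omega (fun x => (u p x - w x)%R) <= K%:E * e%:E)%E.
  move=> HN p Np; have mpk k : measurable_fun setT (fun x => u p x - u' k x).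
    exact: measurable_funB.
  split.
    rewrite /diffsq /sqnorm.
    apply: (@fatou_le _ _ _ mumu setT
      (fun k z => (W (fun x => (u p x - u' k x)%R) z ^+ 2)%:E) _ _ N1) => //.
    - by move=> k; apply: measurable_sqr; exact: measurable_W.
    - by move=> k z _; rewrite lee_fin sqr_ge0.
    - move=> z _; apply: cvg_sqr_EFin; apply: cvgMl; apply: cvgB.
        by apply: cvgB; [exact: cvg_cst|exact: cvw].
      by apply: cvgB; [exact: cvg_cst|exact: cvw].
    - move=> k N1k; have := HN p (phi k) Np (leq_trans N1k (phik k)).
      congr (_ <= _)%E; apply: (diffsq_ae _ _ _ mN N0) => //.
      + exact: measurable_semi_kernel.
      + exact: measurable_funB.
      + by move=> x Nx; rewrite u'E.
  rewrite /L2sq.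
  apply: (@fatou_le _ _ _ mu Omega (fun k x => ((u p x - u' k x) ^+ 2)%:E) _ _ N1) => //.
  - by move=> k; apply: measurable_funTS; exact: measurable_sqr.
  - by move=> k z _; rewrite lee_fin sqr_ge0.
  - by move=> z _; apply: cvg_sqr_EFin; apply: cvgB; [exact: cvg_cst|exact: cvw].
  - move=> k N1k; have := HN p (phi k) Np (leq_trans N1k (phik k)) => h.
    apply: (@le_trans _ _ (L2sq Omega (fun x => (u p x - u (phi k) x)%R))); last first.
      have [h1 _] := HK _ (Vd p (phi k)); apply: le_trans h1 _.
      by apply: lee_wpmul2l => //; rewrite lee_fin ltW.
    rewrite le_eqVlt; apply/orP; left; apply/eqP; apply: ge0_ae_eq_integral => //.
    + by apply: measurable_funTS; exact: measurable_sqr.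
    + by apply: measurable_funTS; apply: measurable_sqr; exact: measurable_funB.
    + by move=> z _; rewrite lee_fin sqr_ge0.
    + by move=> z _; rewrite lee_fin sqr_ge0.
    exists N; split => // x /= H; apply: contrapT => Nx; apply: H => _.
    by rewrite u'E.
have md p : measurable_fun setT (fun x => u p x - w x) by exact: measurable_funB.
have Vdw e N1 : (forall p q, (N1 <= p)%N -> (N1 <= q)%N ->
     (semi (fun x => (u p x - u q x)%R) <= e%:E)%E) -> forall p, (N1 <= p)%N ->
   Vspace nu Omega (fun x => u p x - w x).
  move=> HN p Np; have [h1 h2] := key e N1 HN p Np.
  apply/(VspaceE openO levy_nu); split => //.
    by apply: le_lt_trans h2 _; rewrite -EFinM ltry.
  by apply: le_lt_trans h1 _; rewrite ltry.
have [N1 HN1] := cau 1 ltr01.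
have Vw : Vspace nu Omega w.
  have -> : w = (fun x => 1 * u N1 x + (-1) * (u N1 x - w x)).
    by apply/funext => x; ring.
  apply: (Vspace_comb openO levy_nu); first by have [] := Vu N1.
  exact: Vdw HN1 _ (leqnn _).
exists w; last first.
  move=> e e0; have [N2 HN2] := cau e e0; exists N2 => p Np.
  by have [] := key e N2 HN2 p Np.
split => //; apply/eqP; rewrite -sqrf_eq0 eq_le sqr_ge0 andbT.
apply/ler_addgt0Pl => e e0; rewrite addr0.
pose m := fine (mu Omega) + 1.
have m0 : 0 < m by rewrite ltr_wpDl // fine_ge0.
have [|N2 HN2] := cau (e / (K * m)); first by rewrite divr_gt0 // mulr_gt0.
have [h1 h2] := key _ N2 HN2 _ (leqnn _).
have Vd2 := Vdw _ N2 HN2 _ (leqnn _).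
have -> : \int[mu]_(x in Omega) w x = - \int[mu]_(x in Omega) (u N2 x - w x).
  have [Vu2 u0] := Vu N2.
  rewrite subr_comb (integral_comb openO OM levy_nu 1 (-1) Vu2 Vw).
  by rewrite u0 mulr0 add0r mulN1r opprK.
have [_ l2 _] := Vd2.
rewrite sqrrN; apply: le_trans (integral_sqr_le (md N2) l2) _.
have h3 : fine (L2sq Omega (fun x => (u N2 x - w x)%R)) <= K * (e / (K * m)).
  rewrite -lee_fin fineK // ge0_fin_numE //.
  by apply: integral_ge0 => x _; rewrite lee_fin sqr_ge0.
apply: (@le_trans _ _ (K * (e / (K * m)) * m)).
  apply: ler_pM => //; rewrite ?fine_ge0 ?lerDl //.
  by apply: integral_ge0 => x _; rewrite lee_fin sqr_ge0.
rewrite le_eqVlt; apply/orP; left; apply/eqP.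
by field; rewrite !gt_eqF.
Qed.

End completeness.

(** * The Neumann problem *)

Section neumann_problem.
Context {R : realType} (n : nat).
Local Notation E := 'rV[R]_n.+1.
Local Notation mu := (@lebesgue_rV R n.+1).
Local Notation mumu := (mu \x mu)%E.
Variables (Omega B : set E) (nu : E -> R) (Lambda M K : R).
Hypothesis openO : open Omega.
Hypothesis OM : Omega `<=` [set x | `|x| <= M].
Hypothesis levy_nu : levy_density nu.
Hypothesis full_nu : full_support nu.
Hypothesis openB : open B.
Hypothesis B0 : B !=set0.
Hypothesis BO : B `<=` Omega.
Hypothesis L1 : 1 <= Lambda.
Local Notation semi := (diffsq (semi_kernel Omega nu)).
Local Notation ext := (exterior_sq B nu).
Local Notation nt := (nu_tilde nu B).
Hypothesis K0 : 0 < K.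
Hypothesis HK : forall u : E -> R, Vperp nu Omega u ->
  (L2sq Omega u <= K%:E * semi u)%E /\ (ext u <= K%:E * semi u)%E.
Variables (k : E -> E -> R) (f g : E -> R).
Hypothesis ell : elliptic_kernel nu Lambda k.
Hypothesis f2 : L2 Omega f.
Hypothesis g2 : wL2 (~` Omega) (fun x => (nt x)^-1) g.
Implicit Types u v w : E -> R.

Local Notation D := (diffk (energy_kernel Omega k)).
Local Notation data := (L2norm Omega f + wL2norm (~` Omega) (fun x => (nt x)^-1) g).
Local Notation F := (load Omega f g).
Local Notation V := (Vspace nu Omega).

Let mO : measurable Omega. Proof. exact: open_measurable_rV. Qed.
Let Ooo : (mu Omega < +oo)%E.
Proof. exact: (bounded_finite_measure openO OM). Qed.
Let Lambda_gt0 : 0 < Lambda. Proof. exact: lt_le_trans L1. Qed.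

(** Twice the energy. *)
Definition energy_form u v : R := ip mumu (D u) (D v).
Local Notation a := energy_form.

Lemma measurable_D u : measurable_fun setT u -> measurable_fun setT (D u).
Proof.
move=> mfu; apply: measurable_diffk => //; exact: (measurable_energy_kernel openO ell).
Qed.

Lemma energy_form_sqint u : V u -> sqint mumu (D u).
Proof.
move=> /(VspaceE openO levy_nu)[mfu _ su]; split; first exact: measurable_D.
apply: le_lt_trans (energy_le_semi openO levy_nu L1 ell mfu) _.
apply: lte_mul_pinfty => //; first by rewrite lee_fin mulr_ge0 // ltW.
Qed.

Lemma semi_real u : V u -> semi u = (fine (semi u))%:E.
Proof.
move=> /(VspaceE openO levy_nu)[mfu _ su]; rewrite fineK // ge0_fin_numE //.
exact: sqnorm_ge0.
Qed.

Lemma energy_form_semi u : V u ->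
  fine (semi u) <= Lambda * a u u /\ a u u <= 2 * Lambda * fine (semi u).
Proof.
move=> Vu; have [mfu _ _] := Vu.
have aE : diffsq (energy_kernel Omega k) u = (a u u)%:E.
  by rewrite /diffsq ip_sqnorm //; exact: energy_form_sqint.
split; rewrite -lee_fin EFinM -?aE -?semi_real //.
  exact: semi_le_energy.
exact: energy_le_semi.
Qed.

Lemma energy_form_comb s t u v w : V u -> V v -> V w ->
  a (fun x => s * u x + t * v x) w = s * a u w + t * a v w.
Proof. by move=> Vu Vv Vw; rewrite /a diffk_comb ipDl //; exact: energy_form_sqint. Qed.

Lemma energy_formC u v : a u v = a v u.
Proof. exact: ipC. Qed.

Lemma weak_solutionE (X : (E -> R) -> Prop) u :
  weak_solution X k Omega f g u <-> X u /\ forall v, X v -> a u v = 2 * F v.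
Proof.
rewrite /weak_solution; split=> -[Xu H]; split=> // v Xv; have := H v Xv.
  by rewrite (energyE _ ell) /load => <-; rewrite mulrA mulfV // mul1r.
by rewrite (energyE _ ell) -/(a u v) => ->; rewrite mulrA mulVf // mul1r.
Qed.

Lemma load_bound_energy v : Vperp nu Omega v ->
  F v ^+ 2 <= 4 * K * Lambda * data ^+ 2 * a v v.
Proof.
move=> Pv; have [Vv _] := Pv.
have h := load_bound openO OM levy_nu full_nu openB B0 BO f2 g2 Vv.
apply: le_trans h _; have [h1 h2] := HK Pv; have [h3 _] := energy_form_semi Vv.
have [_ lf _] := (VspaceE openO levy_nu v).1 Vv.
have ef := exterior_fin openO OM levy_nu openB BO Vv.
have l0 : (0 <= L2sq Omega v)%E by apply: integral_ge0 => x _; rewrite lee_fin sqr_ge0.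
have e0 : (0 <= ext v)%E.
  apply: integral_ge0 => x _; rewrite lee_fin mulr_ge0 ?sqr_ge0 //.
  exact/ltW/(nu_tilde_gt0 levy_nu full_nu openB B0 (subset_trans BO OM)).
have {}h1 : fine (L2sq Omega v) <= K * fine (semi v).
  by rewrite -lee_fin EFinM -semi_real // fineK // ge0_fin_numE.
have {}h2 : fine (ext v) <= K * fine (semi v).
  by rewrite -lee_fin EFinM -semi_real // fineK // ge0_fin_numE.
have h4 : fine (L2sq Omega v) + fine (ext v) <= 2 * K * (Lambda * a v v).
  have : K * fine (semi v) <= K * (Lambda * a v v) by rewrite ler_wpM2l // ltW.
  lra.
have d0 : 0 <= 2 * data ^+ 2 by rewrite mulr_ge0 // sqr_ge0.
apply: le_trans (ler_wpM2l d0 h4) _; rewrite le_eqVlt; apply/orP; left; apply/eqP; ring.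
Qed.

Lemma perp_solution_exists : exists u, weak_solution (Vperp nu Omega) k Omega f g u.
Proof.
pose VT : lmodType R := (E -> R^o).
pose a' (u v : VT) : R := a u v.
pose F' (v : VT) : R := 2 * F v.
have Vp (u : VT) : Vperp nu Omega u -> V u by case.
have [|||||||||u Xu Hu] := @riesz_representation R VT (Vperp nu Omega) a' F'
  (16 * K * Lambda * data ^+ 2).
- split; first exact: (Vspace_cst openO OM levy_nu).
  by rewrite /Rintegral integral0.
- by move=> s t v w; exact: (Vperp_comb openO OM levy_nu).
- by move=> v w _ _; exact: energy_formC.
- by move=> s t v w z /Vp Vv /Vp Vw /Vp Vz; exact: energy_form_comb.
- by move=> v _; exact: ip_ge0.
- move=> s t v w /Vp Vv /Vp Vw; rewrite /F'.
  have := load_comb openO OM levy_nu full_nu openB B0 BO s t f2 g2 Vv Vw.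
  by move=> H; rewrite [F _]H; ring.
- by apply: mulr_ge0; [rewrite !mulr_ge0 // ltW|exact: sqr_ge0].
- move=> v Pv; rewrite /F' exprMn; have := load_bound_energy Pv; rewrite /a'; lra.
- move=> u Pu cau.
  have Psub v w : Vperp nu Omega v -> Vperp nu Omega w -> Vperp nu Omega (fun x => v x - w x).
    by move=> Pv Pw; rewrite subr_comb; exact: (Vperp_comb openO OM levy_nu).
  have [e e0|w Pw cvw] := Vperp_complete openO OM levy_nu full_nu openB B0 BO Pu.
    have [|N HN] := cau (e / Lambda); first by rewrite divr_gt0.
    exists N => p q Np Nq; have Vd := Vp _ (Psub _ _ (Pu p) (Pu q)).
    rewrite semi_real // lee_fin; have [h _] := energy_form_semi Vd.
    apply: le_trans h _; rewrite -ler_pdivlMl // mulrC; exact: HN.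
  exists w => // e e0; have [|N HN] := cvw (e / (2 * Lambda)).
    by rewrite divr_gt0 // mulr_gt0.
  exists N => p Np; have Vd := Vp _ (Psub _ _ (Pu p) Pw).
  have := HN p Np; rewrite semi_real // lee_fin => h1; have [_ h] := energy_form_semi Vd.
  by apply: le_trans h _; rewrite -ler_pdivlMl ?mulr_gt0 // mulrC.
by exists u; apply/weak_solutionE; split.
Qed.

(** Test with the solution itself. *)
Lemma perp_solution_estimate u : weak_solution (Vperp nu Omega) k Omega f g u ->
  Vnorm nu Omega u <= Num.sqrt (16 * (K + 1) * K * Lambda ^+ 2) * data.
Proof.
move=> /weak_solutionE[Pu Hu]; have [Vu _] := Pu; have [mfu _ _] := Vu.
have h1 := load_bound_energy Pu; have h2 := Hu u Pu; have a0 : 0 <= a u u by exact: ip_ge0.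
have [h3 _] := energy_form_semi Vu; have [h4 _] := HK Pu.
have [_ lf _] := (VspaceE openO levy_nu u).1 Vu.
have l0 : (0 <= L2sq Omega u)%E by apply: integral_ge0 => x _; rewrite lee_fin sqr_ge0.
have {}h4 : fine (L2sq Omega u) <= K * fine (semi u).
  by rewrite -lee_fin EFinM -semi_real // fineK // ge0_fin_numE.
have d0 : 0 <= data by rewrite addr_ge0 // sqrtr_ge0.
have c0 : 0 <= 16 * (K + 1) * K * Lambda ^+ 2.
  by apply: mulr_ge0; [rewrite !mulr_ge0 // ?addr_ge0 // ltW|exact: sqr_ge0].
have a1 : a u u <= 16 * K * Lambda * data ^+ 2.
  have [az|an] := eqVneq (a u u) 0.
    by rewrite az; apply: mulr_ge0; [rewrite !mulr_ge0 // ltW|exact: sqr_ge0].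
  have ap : 0 < a u u by rewrite lt_def an.
  rewrite -(ler_pM2r ap); have -> : a u u * a u u = 4 * F u ^+ 2 by rewrite h2; ring.
  lra.
rewrite /Vnorm VsemisqE //.
rewrite -[data](ger0_norm d0) -sqrtr_sqr -sqrtrM //; apply: ler_wsqrtr.
have h5 : (K + 1) * fine (semi u) <= (K + 1) * (Lambda * a u u).
  by rewrite ler_wpM2l // addr_ge0 // ltW.
have h6 : (K + 1) * (Lambda * a u u) <= (K + 1) * (Lambda * (16 * K * Lambda * data ^+ 2)).
  by apply: ler_wpM2l; [rewrite addr_ge0 // ltW|apply: ler_wpM2l => //; exact: ltW].
apply: (@le_trans _ _ ((K + 1) * (Lambda * (16 * K * Lambda * data ^+ 2)))).
  by apply: le_trans h6; apply: le_trans h5; lra.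
by rewrite le_eqVlt; apply/orP; left; apply/eqP; ring.
Qed.

Let muO_gt0 : 0 < fine (mu Omega).
Proof.
apply: fine_gt0; rewrite Ooo andbT lt0e measure_ge0 andbT; apply/eqP => O0.
have : (0 < \int[mu]_(h in B) (trunc_density nu h)%:E)%E.
  exact: integral_trunc_density_open.
rewrite null_set_integral ?ltxx //; [exact: open_measurable_rV|..].
  apply: measurable_funTS; apply/measurable_EFinP; exact: measurable_trunc_density.
apply/eqP; rewrite -measure_le0 -O0; apply: le_measure; rewrite ?inE //.
exact: open_measurable_rV.
Qed.

Lemma integral_cst_domain c : \int[mu]_(x in Omega) (cst c x) = c * fine (mu Omega).
Proof. exact: Rintegral_cst. Qed.

Lemma ae_zero_form (d : E -> R) : measurable_fun setT d -> d = cst 0 %[ae mu] ->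
  [/\ V d, L2sq Omega d = 0%E, semi d = 0%E & forall v, V v -> a d v = 0].
Proof.
move=> md [N [mN N0 HN]].
have dN x : ~ N x -> d x = cst 0 x.
  by move=> Nx; apply: contrapT => dx; apply: Nx; apply: HN => /= /(_ I).
have s0 : semi d = 0%E.
  rewrite (diffsq_ae _ md _ mN N0 dN) //; last exact: measurable_semi_kernel.
  by rewrite /diffsq /sqnorm integral0_eq // => z _; rewrite /diffk /= subrr mul0r expr0n.
have l0 : L2sq Omega d = 0%E.
  rewrite /L2sq (@ge0_ae_eq_integral _ _ _ mu _ _ (cst 0%E)) ?integral0 //.
  - by apply: measurable_funTS; exact: measurable_sqr.
  - by move=> x _; rewrite lee_fin sqr_ge0.
  - exists N; split => // x /= H; apply: contrapT => Nx; apply: H => _.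
    by rewrite dN // expr0n.
have Vd : V d by apply/(VspaceE openO levy_nu); rewrite l0 s0; split => //; rewrite ltry.
split => // v Vv.
have [_] := energy_form_semi Vd; rewrite s0 /= mulr0 => a0.
have := cauchy_schwarz (energy_form_sqint Vd) (energy_form_sqint Vv); rewrite -!/(a _ _).
have -> : a d d = 0 by apply/eqP; rewrite eq_le a0 ip_ge0.
by rewrite mul0r => h; apply/eqP; rewrite -sqrf_eq0 eq_le h sqr_ge0.
Qed.

(** Without energy there is no seminorm, hence no square norm for the exterior weight,
    which is positive at every point, inside [Omega] as well. *)
Lemma ae_zero_of_form (d : E -> R) : Vperp nu Omega d -> a d d = 0 -> d = cst 0 %[ae mu].
Proof.
move=> Pd ad; have [Vd _] := Pd; have [md _ _] := Vd.
have [h1 _] := energy_form_semi Vd; have [_ h2] := HK Pd.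
have nt0 x : 0 < nt x by exact: (nu_tilde_gt0 levy_nu full_nu openB B0 (subset_trans BO OM)).
have s0 : semi d = 0%E.
  apply/eqP; rewrite eq_le sqnorm_ge0 andbT semi_real // lee_fin.
  by apply: le_trans h1 _; rewrite ad mulr0.
have e0 : (\int[mu]_y `|(d y ^+ 2 * nt y)%:E| = 0)%E.
  have p0 y : (0 <= (d y ^+ 2 * nt y)%:E)%E by rewrite lee_fin mulr_ge0 ?sqr_ge0 // ltW.
  under eq_integral do rewrite gee0_abs ?p0 //.
  apply/eqP; rewrite eq_le; apply/andP; split; first by move: h2; rewrite s0 mule0.
  exact: integral_ge0.
have me := measurable_exterior OM levy_nu openB BO md.
have [N [mN N0 HN]] := (ae_eq_integral_abs mu measurableT me).1 e0.
exists N; split => // x /= H; apply: HN => /= H2; apply: H => _.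
have : d x ^+ 2 * nt x = 0 by exact: (EFin_inj (H2 I)).
move=> /eqP; rewrite mulf_eq0 (gt_eqF (nt0 x)) orbF sqrf_eq0 => /eqP; exact.
Qed.

Lemma perp_solution_unique u u' : weak_solution (Vperp nu Omega) k Omega f g u ->
  weak_solution (Vperp nu Omega) k Omega f g u' -> u' = u %[ae mu].
Proof.
move=> /weak_solutionE[Pu Hu] /weak_solutionE[Pu' Hu'].
have [[Vu _] [Vu' _]] := (Pu, Pu').
have Pd : Vperp nu Omega (fun x => 1 * u' x + (-1) * u x).
  exact: (Vperp_comb openO OM levy_nu).
have [Vd _] := Pd.
have : a (fun x => 1 * u' x + (-1) * u x) (fun x => 1 * u' x + (-1) * u x) = 0.
  rewrite (energy_form_comb _ _ Vu' Vu Vd) Hu' // Hu //; ring.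
move=> /(ae_zero_of_form Pd); apply: filterS => x /= H _.
by have /eqP := H I; rewrite mul1r mulN1r subr_eq0 => /eqP.
Qed.

Definition compatible : Prop :=
  \int[mu]_(x in Omega) f x + \int[mu]_(y in ~` Omega) g y = 0.

Lemma load_one : F (cst 1) = \int[mu]_(x in Omega) f x + \int[mu]_(y in ~` Omega) g y.
Proof. by rewrite /load; congr (_ + _); apply: eq_Rintegral => x _; rewrite /= mulr1. Qed.

Let V1 : V (cst 1). Proof. exact: (Vspace_cst openO OM levy_nu). Qed.

Lemma energy_form_one u : a (cst 1) u = 0.
Proof.
rewrite /a /ip; have -> : D (cst 1) = cst 0.
  by apply/funext => z; rewrite /diffk /= subrr mul0r.
by rewrite /Rintegral integral0_eq // => z _; rewrite mul0r.
Qed.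

Lemma load_linear s t u v : V u -> V v ->
  F (fun x => s * u x + t * v x) = s * F u + t * F v.
Proof. exact: (load_comb openO OM levy_nu full_nu openB B0 BO s t f2 g2). Qed.

Lemma mean_sub v : V v -> Vperp nu Omega (fun x => 1 * v x + (- mean Omega v) * cst 1 x).
Proof.
move=> Vv; split; first exact: (Vspace_comb openO levy_nu _ _ Vv V1).
rewrite (integral_comb openO OM levy_nu _ _ Vv V1) integral_cst_domain /mean.
by field; rewrite gt_eqF.
Qed.

(** Constants have no energy, so under the compatibility condition testing with
    mean-zero functions is the same as testing with all functions. *)
Lemma solution_of_perp u : compatible ->
  weak_solution (Vperp nu Omega) k Omega f g u -> weak_solution V k Omega f g u.
Proof.
move=> comp /weak_solutionE[Pu Hu]; apply/weak_solutionE; have [Vu _] := Pu; split => // v Vv.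
have := Hu _ (mean_sub Vv).
rewrite energy_formC (energy_form_comb _ _ Vv V1 Vu) energy_form_one.
rewrite (load_linear _ _ Vv V1) load_one comp.
by rewrite !mulr0 !addr0 !mul1r energy_formC.
Qed.

(** Test with the constant 1. *)
Lemma compatible_of_solution w : weak_solution V k Omega f g w -> compatible.
Proof.
move=> /weak_solutionE[Vw Hw]; have := Hw _ V1.
rewrite energy_formC energy_form_one load_one /compatible => /esym/eqP.
by rewrite mulf_eq0 pnatr_eq0 /= => /eqP.
Qed.

(** Subtracting the mean does not change the energy form. *)
Lemma perp_of_solution w : weak_solution V k Omega f g w ->
  weak_solution (Vperp nu Omega) k Omega f g (fun x => w x - mean Omega w).
Proof.
move=> sw; have comp := compatible_of_solution sw.
move: sw => /weak_solutionE[Vw Hw]; apply/weak_solutionE.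
have -> : (fun x => w x - mean Omega w) = (fun x => 1 * w x + (- mean Omega w) * cst 1 x).
  by apply/funext => x; rewrite mul1r mulr1.
have Pw := mean_sub Vw; split => // v Pv; have [Vv _] := Pv.
rewrite (energy_form_comb _ _ Vw V1 Vv) energy_form_one mulr0 addr0 mul1r.
exact: Hw.
Qed.

(** Neither constants nor modifications on a null set change the energy form. *)
Lemma solution_add_cst u w c : weak_solution V k Omega f g u -> measurable_fun setT w ->
  w = (fun x => u x + c) %[ae mu] -> weak_solution V k Omega f g w.
Proof.
move=> /weak_solutionE[Vu Hu] mw wE; apply/weak_solutionE; have [mfu _ _] := Vu.
pose d x := w x - (u x + c).
have md : measurable_fun setT d by apply: measurable_funB => //; exact: measurable_funD.
have [|Vd _ _ ad] := ae_zero_form md.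
  by move: wE; apply: filterS => x /= H _; rewrite /d H // subrr.
pose uc x := 1 * u x + c * cst 1 x.
have Vuc : V uc by exact: (Vspace_comb openO levy_nu).
have -> : w = (fun x => 1 * d x + 1 * uc x).
  by apply/funext => x; rewrite /d /uc /=; ring.
split; first exact: (Vspace_comb openO levy_nu).
move=> v Vv; rewrite (energy_form_comb _ _ Vd Vuc Vv) (ad _ Vv).
rewrite (energy_form_comb _ _ Vu V1 Vv) energy_form_one (Hu _ Vv); ring.
Qed.

End neumann_problem.

Theorem theorem4p11 (R : realType) (n : nat) (Omega B : set 'rV[R]_n.+1)
  (nu : 'rV[R]_n.+1 -> R) (Lambda : R) :
  open Omega -> bounded_set Omega ->
  levy_density nu -> full_support nu ->
  [\/ class_A0 nu, class_A1 nu Omega, class_A2 nu Omega | class_A3 nu Omega] ->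
  open B -> B !=set0 -> B `<=` Omega ->
  1 <= Lambda ->
  exists2 C : R, 0 < C &
  forall (k : 'rV[R]_n.+1 -> 'rV[R]_n.+1 -> R) (f g : 'rV[R]_n.+1 -> R),
  elliptic_kernel nu Lambda k ->
  L2 Omega f ->
  wL2 (~` Omega) (fun x => (nu_tilde nu B x)^-1) g ->
  let data := L2norm Omega f +
              wL2norm (~` Omega) (fun x => (nu_tilde nu B x)^-1) g in
  let solves_perp := weak_solution (Vperp nu Omega) k Omega f g in
  let solves := weak_solution (Vspace nu Omega) k Omega f g in
  let compatible := \int[lebesgue_rV]_(x in Omega) f x +
                    \int[lebesgue_rV]_(y in ~` Omega) g y = 0 in
  exists u : 'rV[R]_n.+1 -> R,
    [/\ solves_perp u,
        forall u', solves_perp u' -> u' = u %[ae lebesgue_rV] &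
        Vnorm nu Omega u <= C * data] /\
    [/\ (exists w, solves w) <-> compatible,
        compatible -> forall w, measurable_fun setT w ->
          (solves w <-> exists c : R, w = (fun x => u x + c) %[ae lebesgue_rV]) &
        compatible -> forall w, solves w ->
          Vnorm nu Omega (fun x => w x - mean Omega w) <= C * data].
Proof.
move=> openO bO levy_nu full_nu _ openB B0 BO L1.
have [M OM] : exists M, Omega `<=` [set x | `|x| <= M].
  by have [M [_ HM]] := bO; exists (M + 1) => x Ox; apply: (HM (M + 1)); rewrite ?ltrDl.
have [K K0 HK] := mean_zero_estimate openO OM levy_nu full_nu openB B0 BO.
exists (Num.sqrt (16 * (K + 1) * K * Lambda ^+ 2)).
  rewrite sqrtr_gt0; apply: mulr_gt0; last by rewrite exprn_gt0 // (lt_le_trans _ L1).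
  by rewrite !mulr_gt0 // addr_gt0.
move=> k f g ell f2 g2 data solves_perp solves compat.
have [u su] := perp_solution_exists openO OM levy_nu full_nu openB B0 BO L1 K0 HK ell f2 g2.
exists u; split; split.
- exact: su.
- move=> u'; exact: (perp_solution_unique openO OM levy_nu full_nu openB B0 BO L1 HK ell su).
- exact: (perp_solution_estimate openO OM levy_nu full_nu openB B0 BO L1 K0 HK ell f2 g2 su).
- split=> [[w sw]|comp]; first exact: (compatible_of_solution openO OM levy_nu ell sw).
  by exists u; exact: (solution_of_perp openO OM levy_nu full_nu openB B0 BO L1 ell f2 g2 comp su).
- move=> comp w mw; split=> [sw|[c wE]].
    exists (mean Omega w).
    have sw' := perp_of_solution openO OM levy_nu full_nu openB B0 BO L1 ell sw.
    have := perp_solution_unique openO OM levy_nu full_nu openB B0 BO L1 HK ell su sw'.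
    by apply: filterS => x /= H _; rewrite -H // subrK.
  apply: (solution_add_cst openO OM levy_nu L1 ell _ mw wE).
  exact: (solution_of_perp openO OM levy_nu full_nu openB B0 BO L1 ell f2 g2 comp su).
- move=> comp w sw.
  have sw' := perp_of_solution openO OM levy_nu full_nu openB B0 BO L1 ell sw.
  exact: (perp_solution_estimate openO OM levy_nu full_nu openB B0 BO L1 K0 HK ell f2 g2 sw').
Qed.
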